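(* Consider the stochastic variational inequality problem SVI$(X,F)$, where $F$ is pseudomonotone-plus on $X$, and let $X^*\neq\emptyset$ be its solution set. Suppose that: (A1) for all $k\ge 0$, almost surely $\mathbb{E}[w_k\mid\mathcal F_k]=0$ and $\mathbb{E}[w_{k+1/2}\mid\mathcal F_{k+1/2}]=0$; (A2) there exists $\nu>0$ such that for all $k\ge 0$, almost surely $\mathbb{E}[\|w_k\|^2\mid\mathcal F_k]\le\nu^2$ and $\mathbb{E}[\|w_{k+1/2}\|^2\mid\mathcal F_{k+1/2}]\le\nu^2$; (A3) $\sum_{k=0}^\infty\gamma_k^2<\infty$; (A4) $\sum_{k=0}^\infty\gamma_k=\infty$; (A5) there exist $L,B>0$ such that $\|F(x)-F(y)\|\le L\|x-y\|$ and $\|F(x)\|\le B/2$ for all $x,y\in X$. Then the extragradient scheme (ESA) generates a sequence $\{x_k\}$ such that, almost surely, $\{x_k\}$ is bounded and any limit point of $\{x_k\}$ is a solution of SVI$(X,F)$.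
   Context: Let $X\subseteq\mathbb{R}^n$ be nonempty, closed and convex, $\xi:\Omega\to\mathbb{R}^d$ a random vector on a probability space, $F(x;\omega):=F(x,\xi(\omega))\in\mathbb{R}^n$ and $F(x):=\mathbb{E}[F(x;\omega)]$ (componentwise). SVI$(X,F)$ is the problem of finding $x^*\in X$ with $(x-x^* )^TF(x^* )\ge 0$ for all $x\in X$; its solution set is $X^*$. $\Pi_X$ is Euclidean projection onto $X$ and $\|\cdot\|$ is the Euclidean norm. Extragradient stochastic approximation scheme (ESA): given $x_0\in X$ and a positive diminishing steplength sequence $\{\gamma_k\}$, for $k\ge 0$, $$x_{k+1/2}:=\Pi_X\big(x_k-\gamma_k(F(x_k)+w_k)\big),\qquad x_{k+1}:=\Pi_X\big(x_k-\gamma_k(F(x_{k+1/2})+w_{k+1/2})\big),$$ where $\omega_k,\omega_{k+1/2}$ are the samples drawn at iteration $k$, $w_k:=F(x_k;\omega_k)-F(x_k)$ and $w_{k+1/2}:=F(x_{k+1/2};\omega_{k+1/2})-F(x_{k+1/2})$. The histories are $\mathcal F_k:=\sigma\{x_0,\omega_0,\omega_{1/2},\omega_1,\dots,\omega_{k-1/2}\}$ and $\mathcal F_{k+1/2}:=\sigma(\mathcal F_k\cup\{\omega_k\})$. A continuous map $F$ is pseudomonotone on $X$ if for all $x,y\in X$, $(x-y)^TF(y)\ge0\Rightarrow(x-y)^TF(x)\ge0$. It is pseudomonotone-plus on $X$ if it is pseudomonotone on $X$ and for all $x,y\in X$, [$(x-y)^TF(y)\ge 0$ and $(x-y)^TF(x)=0$]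 implies $F(x)=F(y)$. *)

(* Defs.v *)
From HB Require Import structures.
From mathcomp Require Import all_boot all_order all_algebra.
From mathcomp Require Import all_classical all_reals all_analysis.

Set Implicit Arguments.
Unset Strict Implicit.
Unset Printing Implicit Defensive.

Import Order.TTheory GRing.Theory Num.Theory.
Import numFieldNormedType.Exports.

Local Open Scope classical_set_scope.
Local Open Scope ring_scope.

(* The library topologizes 'rV[R]_n with the sup norm; its open sets, closed
   sets, continuous maps, cluster points and Borel sets are those of the
   Euclidean norm below. *)
Definition dotrv (R : realType) (n : nat) (u v : 'rV[R]_n) : R :=
  \sum_(i < n) u ord0 i * v ord0 i.

Definition enorm (R : realType) (n : nat) (u : 'rV[R]_n) : R :=
  Num.sqrt (dotrv u u).

Notation borelRV R n := (g_sigma_algebraType (@open 'rV[R]_n)).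

Section euclidean_vi.
Context (R : realType) (n : nat).
Implicit Types (X : set 'rV[R]_n) (F : 'rV[R]_n -> 'rV[R]_n).

(* [get] returns the nearest point of X to y, which exists and is unique when
   X is nonempty, closed and convex, and an arbitrary vector otherwise. *)
Definition eproj X (y : 'rV[R]_n) : 'rV[R]_n :=
  get [set p | X p /\ forall z, X z -> enorm (y - p) <= enorm (y - z)].

Definition SVI X F : set 'rV[R]_n :=
  [set xs | X xs /\ forall x, X x -> 0 <= dotrv (x - xs) (F xs)].

Definition pseudomonotone X F : Prop :=
  {within X, continuous F} /\
  forall x y, X x -> X y ->
    0 <= dotrv (x - y) (F y) -> 0 <= dotrv (x - y) (F x).

Definition pseudomonotone_plus X F : Prop :=
  pseudomonotone X F /\
  forall x y, X x -> X y ->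
    0 <= dotrv (x - y) (F y) -> dotrv (x - y) (F x) = 0 -> F x = F y.

End euclidean_vi.

Section conditional_expectation.
Context (R : realType) (d : measure_display) (T : measurableType d)
        (Q : probability T R).

(* Y is a version of E[Z | G], for G a sub-sigma-algebra and Z integrable;
   a conditional expectation is determined only up to a Q-null set. *)
Definition is_cond_exp (G : set (set T)) (Z Y : T -> R) : Prop :=
  [/\ Q.-integrable [set: T] (EFin \o Z),
      Q.-integrable [set: T] (EFin \o Y),
      preimage_set_system [set: T] Y measurable `<=` G &
      forall A, G A ->
        (\int[Q]_(t in A) (Y t)%:E = \int[Q]_(t in A) (Z t)%:E)%E].

(* Versions of E[Z | G] agree almost surely, so an almost sure property of
   E[Z | G] holds for every version once it holds for one. *)
Definition cond_exp_ae_eq (G : set (set T)) (Z : T -> R) (c : R) : Prop :=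
  exists2 Y, is_cond_exp G Z Y & \forall t \ae Q, Y t = c.

Definition cond_exp_ae_le (G : set (set T)) (Z : T -> R) (c : R) : Prop :=
  exists2 Y, is_cond_exp G Z Y & \forall t \ae Q, Y t <= c.

End conditional_expectation.

Section histories.
Context (R : realType) (n : nat).
Context (d d' : measure_display).
Context (Omega : measurableType d) (T : measurableType d').
Variables (x0 : T -> borelRV R n) (om omh : nat -> T -> Omega).

(* om k and omh k stand for omega_k and omega_(k+1/2). *)
Definition history (k : nat) : set (set T) :=
  <<s g_sigma_algebra_preimage x0 `|`
      \bigcup_(i in [set i | (i < k)%N])
        (g_sigma_algebra_preimage (om i) `|` g_sigma_algebra_preimage (omh i)) >>.

Definition history_half (k : nat) : set (set T) :=
  <<s history k `|` g_sigma_algebra_preimage (om k) >>.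

End histories.

(* Main.v *)
Require Import Defs.
From HB Require Import structures.
From mathcomp Require Import all_boot all_order all_algebra.
From mathcomp Require Import all_classical all_reals all_analysis.
From mathcomp Require Import measurable_realfun ring lra.

Set Implicit Arguments.
Unset Strict Implicit.
Unset Printing Implicit Defensive.

Import Order.TTheory GRing.Theory Num.Theory.
Import numFieldNormedType.Exports.

Local Open Scope classical_set_scope.
Local Open Scope ring_scope.

(** Write [V_k] for the squared distance from [x_k] to a fixed solution [p].
    The obtuse-angle property of the projection gives
    [V_(k+1) <= V_k + e_k - 2 gamma_k F(y_k).(y_k - p) - 2 gamma_k w'_k.(y_k - p)],
    where [y_k] is the half iterate, [w'_k] the noise met there, and [e_k] is
    [gamma_k ^ 2] times the squared difference of the two sampled directions
    ([extragradient_step]). The gap [F(y_k).(y_k - p)] is nonnegative by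
    pseudomonotonicity. As [F] is bounded and the noises are bounded in [L2],
    the expectations of the [e_k] are summable, so [\sum_k e_k] is finite almost
    surely ([ae_cvg_series]).

    The martingale term is tamed by dividing by [W_k = 1 + V_k]. The vectors
    [u_k = (y_k - p) / W_k], set to zero on the event that the prediction step
    is longer than [1], are bounded by [2] and known before [w'_k] is drawn; so
    the variables [xi_k = gamma_k u_k.w'_k] are the increments of a martingale
    bounded in [L2], whose sum converges almost surely ([weighted_noise_cvg],
    from a maximal inequality for the sums stopped at a given level,
    [L2_martingale_cvg]). The division makes these increments square-integrable
    whatever the law of [x_0]. Almost surely
    [gamma_k |F(x_k) + w_k|] tends to [0], so the truncation is eventually idle
    and [W_(k+1) <= W_k (1 + e_k - 2 xi_k) - 2 gamma_k F(y_k).(y_k - p)].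
    The product of [W_k] and [exp(- \sum_(i < k) (e_i - 2 xi_i))] is then
    nonincreasing: [W_k] converges, and [\sum_k gamma_k F(y_k).(y_k - p)] is
    finite ([perturbed_decrease], [extragradient_path_cvg]).

    All this holds almost surely for all [p] in a countable dense set of
    solutions at once. Since [\sum_k gamma_k] diverges, the gap at one such [p]
    tends to [0] along a subsequence of the bounded sequence [y_k]; a cluster
    point [q] of that subsequence lies in [X] and satisfies [F(q).(q - p) = 0],
    hence [F(q) = F(p)] because [F] is pseudomonotone-plus, and [q] is a solution
    ([SVI_gap_eq0], [seq_cluster_SVI]). The distances from [x_k] to solutions
    of the dense set close to [q] converge, so [x_k] tends to [q]
    ([trajectory_cvg_SVI]): the trajectory is bounded and [q] is its only limit
    point. *)

(** * Euclidean norm on row vectors *)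

Section euclidean.
Context (R : realType) (n : nat).
Implicit Types (u v z : 'rV[R]_n) (a b : R).

Lemma dotrvC u v : dotrv u v = dotrv v u.
Proof. by apply: eq_bigr => i _; rewrite mulrC. Qed.

Lemma dotrvDl u v z : dotrv (u + v) z = dotrv u z + dotrv v z.
Proof. by rewrite -big_split; apply: eq_bigr => i _; rewrite mxE mulrDl. Qed.

Lemma dotrvZl a u v : dotrv (a *: u) v = a * dotrv u v.
Proof. by rewrite mulr_sumr; apply: eq_bigr => i _; rewrite mxE mulrA. Qed.

Lemma dotrvNl u v : dotrv (- u) v = - dotrv u v.
Proof. by rewrite -scaleN1r dotrvZl mulN1r. Qed.

Lemma dotrvDr u v z : dotrv z (u + v) = dotrv z u + dotrv z v.
Proof. by rewrite !(dotrvC z) dotrvDl. Qed.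

Lemma dotrvZr a u v : dotrv v (a *: u) = a * dotrv v u.
Proof. by rewrite !(dotrvC v) dotrvZl. Qed.

Lemma dotrvNr u v : dotrv v (- u) = - dotrv v u.
Proof. by rewrite !(dotrvC v) dotrvNl. Qed.

Definition dotrvE := (dotrvDl, dotrvDr, dotrvNl, dotrvNr, dotrvZl, dotrvZr).

Lemma dotrv_ge0 u : 0 <= dotrv u u.
Proof. by apply: sumr_ge0 => i _; rewrite -expr2 sqr_ge0. Qed.

Lemma enorm_ge0 u : 0 <= enorm u. Proof. exact: sqrtr_ge0. Qed.

Lemma enorm2 u : enorm u ^+ 2 = dotrv u u.
Proof. by rewrite sqr_sqrtr // dotrv_ge0. Qed.

Lemma enorm0 : enorm (0 : 'rV[R]_n) = 0.
Proof. by rewrite /enorm -(scale0r 0) dotrvZl mul0r sqrtr0. Qed.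

Lemma le_sqr_enorm u a : 0 <= a -> dotrv u u <= a ^+ 2 -> enorm u <= a.
Proof. by move=> a0 h; rewrite -(@ler_pXn2r _ 2) ?nnegrE ?enorm_ge0// enorm2. Qed.

Lemma coord_le_enorm u i : `|u ord0 i| <= enorm u.
Proof.
rewrite -(@ler_pXn2r _ 2) ?nnegrE ?enorm_ge0// enorm2 /dotrv (bigD1 i)//=.
by rewrite real_normK ?num_real// -expr2 lerDl sumr_ge0// => j _; rewrite -expr2 sqr_ge0.
Qed.

Lemma dotrv_le_enorm u v : dotrv u v <= enorm u * enorm v.
Proof.
have [u0|u0] := eqVneq (enorm u) 0.
  rewrite u0 mul0r /dotrv big1// => i _.
  have := coord_le_enorm u i; rewrite u0 normr_le0 => /eqP ->; exact: mul0r.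
have [v0|v0] := eqVneq (enorm v) 0.
  rewrite v0 mulr0 /dotrv big1// => i _.
  have := coord_le_enorm v i; rewrite v0 normr_le0 => /eqP ->; exact: mulr0.
have p : 0 < enorm u * enorm v by rewrite mulr_gt0// lt0r ?u0 ?v0 enorm_ge0.
have := dotrv_ge0 (enorm v *: u - enorm u *: v).
rewrite !dotrvE (dotrvC v u) -!enorm2 => h.
rewrite -(ler_pM2l p); nra.
Qed.

Lemma ler_enormD u v : enorm (u + v) <= enorm u + enorm v.
Proof.
apply: le_sqr_enorm; first by rewrite addr_ge0 ?enorm_ge0.
by rewrite !dotrvE (dotrvC v u) -!enorm2; have := dotrv_le_enorm u v; nra.
Qed.

Lemma enormN u : enorm (- u) = enorm u.
Proof. by rewrite /enorm !dotrvE opprK. Qed.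

Lemma enormZ a u : enorm (a *: u) = `|a| * enorm u.
Proof.
by rewrite /enorm !dotrvE mulrA -expr2 sqrtrM ?sqr_ge0// sqrtr_sqr.
Qed.

Lemma enormC u v : enorm (u - v) = enorm (v - u).
Proof. by rewrite -enormN opprB. Qed.

Lemma ler_dist_enormD z u v : enorm (u - v) <= enorm (u - z) + enorm (z - v).
Proof. by rewrite -[u - v](subrKA z) ler_enormD. Qed.

Lemma enorm_eq0 u : enorm u = 0 -> u = 0.
Proof.
move=> u0; apply/rowP => i; rewrite mxE; apply/eqP.
by rewrite -normr_le0 -u0 coord_le_enorm.
Qed.

(** The sup norm, which carries the topology, and the Euclidean norm are
    equivalent. *)
Lemma mx_norm_le_enorm u : `|u| <= enorm u.
Proof.
rewrite [leLHS]/Num.Def.normr/= mx_normrE; apply/bigmax_leP; split; first exact: enorm_ge0.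
by move=> [i j] _ /=; rewrite ord1 coord_le_enorm.
Qed.

Lemma coord_le_mx_norm u i : `|u ord0 i| <= `|u|.
Proof.
rewrite [leRHS]/Num.Def.normr/= mx_normrE; apply/bigmax_geP; right.
by exists (ord0, i).
Qed.

Lemma enorm_le_mx_norm u : enorm u <= n%:R * `|u|.
Proof.
apply: (@le_trans _ _ (\sum_(i < n) `|u|)); last by rewrite sumr_const card_ord mulr_natl.
apply: le_sqr_enorm; first exact: sumr_ge0.
rewrite expr2 mulr_suml; apply: ler_sum => i _.
rewrite mulr_sumr (bigD1 i)//= ler_wpDr//; first by rewrite sumr_ge0.
rewrite -expr2 -[leLHS]real_normK ?num_real// expr2.
by apply: ler_pM => //; exact: coord_le_mx_norm.
Qed.

Lemma enorm_continuous_at u e : 0 < e ->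
  \forall v \near u, enorm (v - u) < e.
Proof.
move=> e0; have d0 : 0 < e / n.+1%:R by rewrite divr_gt0.
near=> v; apply: (le_lt_trans (enorm_le_mx_norm _)).
have : `|v - u| < e / n.+1%:R.
  by rewrite distrC; near: v; exact: (@cvgr_dist_lt _ _ _ _ _ (@id 'rV[R]_n) u).
rewrite ltr_pdivlMr// mulrC; apply: le_lt_trans.
by rewrite ler_wpM2r// ler_nat.
Unshelve. all: by end_near. Qed.

End euclidean.

Lemma lipschitz_enorm_continuous (R : realType) n k (f : 'rV[R]_n -> 'rV[R]_k) (L : R) :
  (forall u v, enorm (f u - f v) <= L * enorm (u - v)) -> continuous f.
Proof.
move=> fL u; apply/(@cvgrPdist_lt _ 'rV[R]_k _ (nbhs u) _ f (f u)) => e e0.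
have L0 : 0 < `|L| + 1 by rewrite ltr_wpDl.
near=> v.
have /= : enorm (v - u) < e / (`|L| + 1).
  by near: v; apply: enorm_continuous_at; rewrite divr_gt0.
rewrite ltr_pdivlMr// => h.
apply: le_lt_trans (mx_norm_le_enorm _) _; apply: le_lt_trans (fL _ _) _; rewrite enormC.
have := enorm_ge0 (v - u); have := ler_norm L; nra.
Unshelve. all: by end_near. Qed.

(** * Projection onto a closed convex set *)

Section projection.
Context (R : realType) (n : nat).
Implicit Types (X : set 'rV[R]_n) (u v y z : 'rV[R]_n).

Lemma enormB_continuous y : continuous (fun z => enorm (y - z)).
Proof.
move=> z; apply/(@cvgrPdist_lt _ R^o _ (nbhs z) _ (fun z => enorm (y - z))) => e e0.
near=> v.
have : enorm (v - z) < e by near: v; exact: enorm_continuous_at.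
apply: le_lt_trans; rewrite ler_distl.
have := ler_dist_enormD z y v; have := ler_dist_enormD v y z.
rewrite (enormC z v); lra.
Unshelve. all: by end_near. Qed.

Lemma enorm_le_compact X a M : closed X ->
  compact (X `&` [set z | enorm (a - z) <= M]).
Proof.
move=> cX; apply: bounded_closed_compact.
  exists (enorm a + M); split; first exact: num_real.
  move=> K hK z [_ /= zM]; apply: le_trans (mx_norm_le_enorm _) _.
  have := ler_dist_enormD a z 0; rewrite !subr0 (enormC z a); lra.
apply: closedI => //.
rewrite (_ : [set z | _] = (fun z => enorm (a - z)) @^-1` [set r | r <= M])//.
apply: closed_comp; last exact: closed_le.
by move=> z _; exact: enormB_continuous.
Qed.

Lemma convex_setP X p z t : convex_set X -> X p -> X z -> 0 <= t <= 1 ->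
  X (p + t *: (z - p)).
Proof.
move=> cX Xp Xz /andP[t0 t1].
have t01 : Itv.spec (@Itv.num_sem _) (Itv.Real `[0%Z, 1%Z]) t.
  by rewrite /Itv.num_sem/= in_itv/= t0 t1 num_real.
have := cX z p (Itv.mk t01) (mem_set Xz) (mem_set Xp).
rewrite inE => h; suff -> : p + t *: (z - p) = t *: z + (1 - t) *: p by exact: h.
by rewrite scalerBr scalerBl scale1r addrCA.
Qed.

Lemma eprojP X y : X !=set0 -> closed X ->
  X (eproj X y) /\ forall z, X z -> enorm (y - eproj X y) <= enorm (y - z).
Proof.
move=> [a Xa] cX.
apply: (@getPex _
  [set p | X p /\ forall z, X z -> enorm (y - p) <= enorm (y - z)]).
have [] := @compact_EVT_min _ _ (fun z => enorm (y - z))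
    _ _ (@enorm_le_compact X y (enorm (y - a)) cX).
- by exists a; split => /=.
- by apply: continuous_subspaceT => z; exact: enormB_continuous.
move=> p; rewrite inE => -[Xp pa] pmin; exists p; split => // z Xz.
have [za|/ltW az] := leP (enorm (y - z)) (enorm (y - a)).
  by apply: pmin; rewrite inE.
exact: le_trans az.
Qed.

(** At the projection [p] of [y], the vectors from [p] to [y] and to any point
    of [X] make an obtuse angle. *)
Lemma eproj_dotrv_le0 X y z : X !=set0 -> closed X -> convex_set X -> X z ->
  dotrv (y - eproj X y) (z - eproj X y) <= 0.
Proof.
move=> X0 cX vX Xz; have [Xp pmin] := eprojP y X0 cX.
set p := eproj X y in Xp pmin *.
rewrite leNgt; apply/negP => c0.
set c := dotrv _ _ in c0.
pose q := dotrv (z - p) (z - p).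
have q0 : 0 <= q by exact: dotrv_ge0.
(* moving from p towards z by this fraction t would bring one closer to y *)
pose t := c / (c + q).
have cq : 0 < c + q by rewrite ltr_wpDr.
have t0 : 0 < t by rewrite divr_gt0.
have t1 : t <= 1 by rewrite ler_pdivrMr// mul1r lerDl.
have /pmin : X (p + t *: (z - p)) by apply: convex_setP; rewrite ?(ltW t0).
rewrite -(@ler_pXn2r _ 2) ?nnegrE ?enorm_ge0// !enorm2 opprD addrA.
have -> : dotrv (y - p - t *: (z - p)) (y - p - t *: (z - p)) =
    dotrv (y - p) (y - p) - 2 * (t * c) + t * (t * q).
  rewrite /c /q; move: (y - p) (z - p) => a b.
  by rewrite !dotrvE (dotrvC b a); ring.
have tE : t * (c + q) = c by rewrite divfK// gt_eqF.
have e : t * (t * q) = t * c - t * (t * c).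
  by rewrite -[in X in X - _]tE; ring.
have tc : 0 < t * c by exact: mulr_gt0.
have ttc : 0 < t * (t * c) by exact: mulr_gt0.
rewrite e; lra.
Qed.

Lemma eproj_nonexpansive X u v : X !=set0 -> closed X -> convex_set X ->
  enorm (eproj X u - eproj X v) <= enorm (u - v).
Proof.
move=> X0 cX vX.
have [Xp _] := eprojP u X0 cX; have [Xq _] := eprojP v X0 cX.
have h1 := eproj_dotrv_le0 u X0 cX vX Xq.
have h2 := eproj_dotrv_le0 v X0 cX vX Xp.
set p := eproj X u in Xp h1 h2 *; set q := eproj X v in Xq h1 h2 *.
have h : enorm (p - q) ^+ 2 <= enorm (u - v) * enorm (p - q).
  apply: le_trans (dotrv_le_enorm _ _); rewrite enorm2.
  have -> : u - v = (p - q) + ((u - p) - (v - q)) by apply/rowP => i; rewrite !mxE; ring.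
  rewrite (dotrvDl (p - q)) lerDl.
  rewrite (dotrvDl (u - p)) dotrvNl -(opprB q p) dotrvNr.
  move: h2; rewrite -(opprB q p) dotrvNr; lra.
have [p0|p0] := eqVneq (enorm (p - q)) 0; first by rewrite p0 enorm_ge0.
by rewrite -(@ler_pM2r _ (enorm (p - q))) -?expr2// lt0r p0 enorm_ge0.
Qed.

Lemma eproj_id X u : X !=set0 -> closed X -> X u -> eproj X u = u.
Proof.
move=> X0 cX Xu; have [_ /(_ _ Xu)] := eprojP u X0 cX.
rewrite subrr enorm0 => h; apply/esym/eqP; rewrite -subr_eq0; apply/eqP/enorm_eq0.
by apply/eqP; rewrite eq_le h enorm_ge0.
Qed.

(** [p] is a cluster point of the sequence [u]: infinitely many terms lie in
    each Euclidean ball around [p]. *)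
Definition seq_cluster (u : nat -> 'rV[R]_n) p :=
  forall e, 0 < e -> forall N, exists2 i, (N <= i)%N & enorm (u i - p) < e.

Lemma cluster_seq_cluster (u : nat -> 'rV[R]_n) p :
  cluster (u @ \oo) p -> seq_cluster u p.
Proof.
move=> up e e0 N.
have [z [[i /= Ni <-] zp]] := up (u @` [set i | (N <= i)%N])
  [set z | enorm (z - p) < e] (filterS (fun i Ni => imageP u Ni) (nbhs_infty_ge N))
  (enorm_continuous_at p e0).
by exists i.
Qed.

Lemma bounded_seq_cluster X (u : nat -> 'rV[R]_n) a M : closed X ->
  (forall k, X (u k)) -> (forall k, enorm (u k - a) <= M) ->
  exists2 p, X p & seq_cluster u p.
Proof.
move=> cX Xu uM.
have [|p [[Xp _] /cluster_seq_cluster up]] :=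
    @enorm_le_compact X a M cX (u @ \oo) _.
  by exists 0%N => // k _ /=; split=> //=; rewrite enormC.
by exists p.
Qed.

End projection.

(** * Perturbed decrease of real sequences, and the extragradient step *)

Section real_sequences.
Context (R : realType).
Implicit Types (W D a g c : R^nat).

(** With [P k = expR (- \sum_(i < k) a i)], which converges to a positive limit,
    the sequence [W k * P k] is nonincreasing from [K] on, and its total decrease
    bounds the sums of the [D k * P k.+1]. *)
Lemma perturbed_decrease W D a K :
  (forall k, 0 <= W k) -> (forall k, 0 <= D k) -> cvgn (series a) ->
  (forall k, (K <= k)%N -> W k.+1 <= W k * (1 + a k) - D k) ->
  cvgn W /\ exists M, forall k, series D k <= M.
Proof.
move=> W0 D0 ca Wdec.
pose P k := expR (- series a k).
have P0 k : 0 < P k by exact: expR_gt0.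
pose Z k := W k * P k.
have Z0 k : 0 <= Z k by rewrite mulr_ge0// ltW.
have Zdec k : (K <= k)%N -> Z k.+1 + D k * P k.+1 <= Z k.
  move=> /Wdec Wk; rewrite /Z.
  have -> : P k = expR (a k) * P k.+1.
    by rewrite /P -expRD seriesSr; congr expR; ring.
  rewrite mulrA -mulrDl ler_pM2r//.
  rewrite -lerBrDr; apply: (le_trans Wk); rewrite lerB// ler_wpM2l//.
  exact: expR_ge1Dx.
(* the partial sums of a are bounded, so P is bounded below by a positive constant *)
have [M [_ /(_ (M + 1))]] := cvg_seq_bounded ca.
rewrite ltrDl ltr01 => /(_ isT) aM.
have PM k : expR (- (M + 1)) <= P k.
  rewrite ler_expR lerN2; exact: le_trans (ler_norm _) (aM k I).
have ZD k : Z (k + K)%N + expR (- (M + 1)) * (series D (k + K)%N - series D K) <= Z K.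
  elim: k => [|k ih]; first by rewrite add0n subrr mulr0 addr0.
  rewrite addSn seriesSr.
  have := Zdec _ (leq_addl k K); have := PM (k + K).+1; have := D0 (k + K)%N.
  move: ih; nra.
split.
  have cZ : cvgn (fun k => Z (k + K)%N).
    apply: nonincreasing_is_cvgn.
      apply/nonincreasing_seqP => k; rewrite addSn.
      apply: le_trans (Zdec _ (leq_addl k K)).
      by rewrite lerDl mulr_ge0// ltW.
    by exists 0 => _ [k _ <-].
  have {}cZ : cvgn Z by apply/cvg_ex; case/cvg_ex: cZ => l; rewrite cvg_shiftn => ?; exists l.
  have -> : W = Z \* (fun k => expR (series a k)).
    by apply/funext => k /=; rewrite /Z /P -mulrA -expRD addNr expR0 mulr1.
  apply: is_cvgM => //; apply/cvg_ex; exists (expR (limn (series a))).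
  by apply: (cvg_comp _ _ ca); exact: continuous_expR.
exists (series D K + Z K / expR (- (M + 1))) => k.
have [kK|Kk] := leqP k K.
  rewrite -[leLHS]addr0 lerD ?divr_ge0 ?expR_ge0//.
  exact: nondecreasing_series.
rewrite -lerBlDl ler_pdivlMr ?expR_gt0// mulrC.
by have := ZD (k - K)%N; rewrite subnK ?(ltnW Kk)//; apply: le_trans; rewrite lerDr.
Qed.

Lemma bounded_weighted_series_frequently_small g c M :
  (forall k, 0 < g k) -> series g @ \oo --> +oo ->
  (forall k, 0 <= c k) -> (forall k, series (fun k => g k * c k) k <= M) ->
  forall e, 0 < e -> forall N, exists2 k, (N <= k)%N & c k < e.
Proof.
move=> g0 gy c0 gcM e e0 N; apply: contrapT => nc.
have ce k : (N <= k)%N -> e <= c k.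
  by move=> Nk; rewrite leNgt; apply/negP => ck; apply: nc; exists k.
have gM k : series g k <= series g N + M / e.
  have [kN|Nk] := leqP k N.
    rewrite -[leLHS]addr0 lerD//.
      by apply: nondecreasing_series => // i _ _; exact: ltW.
    rewrite divr_ge0 ?(ltW e0)//; apply: le_trans (gcM 0%N).
    by rewrite /series/= big_geq.
  rewrite -lerBlDl sub_series (ltnW Nk) ler_pdivlMr// mulr_suml.
  apply: le_trans (gcM k); rewrite -[leRHS]subr0.
  apply: (@le_trans _ _ (series (fun i => g i * c i) k - series (fun i => g i * c i) N)).
    rewrite sub_series (ltnW Nk) !big_nat; apply: ler_sum => i /andP[Ni _].
    by rewrite ler_wpM2l ?(ltW (g0 i))// ce.
  by rewrite lerB// sumr_ge0// => i _; rewrite mulr_ge0// ltW.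
move/cvgryPgt/(_ (series g N + M / e)): gy => [k _ /(_ k (leqnn k))] /=.
by rewrite ltNge gM.
Qed.

End real_sequences.

Section extragradient_step.
Context (R : realType) (n : nat) (X : set 'rV[R]_n).
Hypotheses (X0 : X !=set0) (cX : closed X) (vX : convex_set X).

(** One extragradient step with directions [g0] (prediction) and [g]
    (correction). It follows from the obtuse-angle property of the two
    projections and from the nonnegativity of the squared norms of
    [v - y - c *: (g0 - g)] and [u - y]. *)
Lemma extragradient_step (u y v p g0 g : 'rV[R]_n) (c : R) :
  X p -> y = eproj X (u - c *: g0) -> v = eproj X (u - c *: g) ->
  enorm (v - p) ^+ 2 <=
    enorm (u - p) ^+ 2 + c ^+ 2 * enorm (g0 - g) ^+ 2 - 2 * c * dotrv g (y - p).
Proof.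
move=> Xp yE vE.
have [Xv _] := eprojP (u - c *: g) X0 cX; rewrite -vE in Xv.
have h1 := eproj_dotrv_le0 (u - c *: g0) X0 cX vX Xv; rewrite -yE in h1.
have h2 := eproj_dotrv_le0 (u - c *: g) X0 cX vX Xp; rewrite -vE in h2.
have h3 := dotrv_ge0 ((v - y) - c *: (g0 - g)).
have h4 := dotrv_ge0 (u - y).
rewrite !enorm2.
move: h1 h2 h3 h4; rewrite !dotrvE.
rewrite ?(dotrvC y u) ?(dotrvC v u) ?(dotrvC p u) ?(dotrvC g u) ?(dotrvC g0 u).
rewrite ?(dotrvC y v) ?(dotrvC p v) ?(dotrvC g v) ?(dotrvC g0 v).
rewrite ?(dotrvC p y) ?(dotrvC g y) ?(dotrvC g0 y) ?(dotrvC g p) ?(dotrvC g0 p) ?(dotrvC g g0).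
nra.
Qed.

End extragradient_step.

(** * Convergence of a trajectory to a solution *)

Section trajectory.
Context (R : realType) (n : nat) (X : set 'rV[R]_n) (F : 'rV[R]_n -> 'rV[R]_n).
Hypotheses (X_closed : closed X) (F_pm_plus : pseudomonotone_plus X F).

Lemma SVI_dotrv_ge0 p y : SVI X F p -> X y -> 0 <= dotrv (F y) (y - p).
Proof.
by move=> [Xp sp] Xy; rewrite dotrvC; apply: F_pm_plus.1.2 => //; exact: sp.
Qed.

(** A point with zero gap at a solution [p] has, by pseudomonotonicity-plus, the
    same value of [F] as [p], hence is a solution. *)
Lemma SVI_gap_eq0 p q : SVI X F p -> X q -> dotrv (F q) (q - p) = 0 -> SVI X F q.
Proof.
move=> [Xp sp] Xq; rewrite dotrvC => q0; split => // z Xz.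
have Fqp : F q = F p by apply: F_pm_plus.2 => //; exact: sp.
rewrite -(subrKA p z) dotrvDl -(opprB q p) dotrvNl q0 oppr0 addr0 Fqp; exact: sp.
Qed.

Context (L B : R).
Hypotheses (F_lip : forall u v, X u -> X v -> enorm (F u - F v) <= L * enorm (u - v))
  (F_bnd : forall u, X u -> enorm (F u) <= B / 2) (L_gt0 : 0 < L) (B_gt0 : 0 < B).

(** A cluster point of a sequence along which the gap at the solution [p] tends to
    zero has zero gap, hence is a solution. *)
Lemma seq_cluster_SVI p (u : nat -> 'rV[R]_n) q :
  SVI X F p -> (forall i, X (u i)) -> X q -> seq_cluster u q ->
  (forall i, dotrv (F (u i)) (u i - p) < i.+1%:R^-1) -> SVI X F q.
Proof.
move=> sp Xu Xq uq small; apply: (SVI_gap_eq0 sp) => //.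
have c0 := SVI_dotrv_ge0 sp Xq.
set c := dotrv _ _ in c0 *.
apply/eqP; rewrite eq_le c0 andbT leNgt; apply/negP => {}c0.
(* within distance e of q the gap varies by at most K * e, which is at most half
   of the gap c at q, assumed positive *)
pose K := L * (1 + enorm (q - p)) + B.
have K0 : 0 < K by rewrite addr_gt0// mulr_gt0// ltr_wpDr ?enorm_ge0.
pose e := Num.min 1 (c / (2 * K)).
have e0 : 0 < e by rewrite lt_min ltr01 divr_gt0// mulr_gt0.
have [N _ cN] : \forall i \near \oo, i.+1%:R^-1 < c / 2.
  by apply: near_infty_natSinv_lt (PosNum (divr_gt0 c0 (ltr0n _ 2))).
have [i Ni ui] := uq e e0 N.
have [ui1 uic] : enorm (u i - q) <= 1 /\ enorm (u i - q) * K <= c / 2.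
  move: ui; rewrite lt_min => /andP[/ltW ? /ltW h]; split=> //.
  rewrite -ler_pdivlMr//; apply: le_trans h _.
  by rewrite invfM mulrA.
have Fu := small i; have := cN i Ni => /= {}cN.
have cE : c = dotrv (F (u i)) (u i - p) + dotrv (F q - F (u i)) (u i - p)
            + dotrv (F q) (q - u i).
  rewrite /c; move: (F q) (F (u i)) (u i) => a b v; rewrite !dotrvE; ring.
have h1 := dotrv_le_enorm (F q - F (u i)) (u i - p).
have h2 := dotrv_le_enorm (F q) (q - u i).
have h3 := F_lip Xq (Xu i); have h4 := F_bnd Xq.
have h5 := ler_dist_enormD q (u i) p.
rewrite (enormC q (u i)) in h2 h3.
have d0 := enorm_ge0 (u i - q); have m0 := enorm_ge0 (u i - p).
have h6 : enorm (F q - F (u i)) * enorm (u i - p) <=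
    L * enorm (u i - q) * (1 + enorm (q - p)).
  by apply: ler_pM => //; [exact: enorm_ge0|lra].
have h7 : enorm (F q) * enorm (u i - q) <= B / 2 * enorm (u i - q) by rewrite ler_wpM2r.
have h8 : 0 <= B * enorm (u i - q) by rewrite mulr_ge0// ltW.
have {Fu cN}h9 := lt_trans Fu cN.
move: uic; rewrite /K mulrDr => uic; clear -h9 cE h1 h2 h6 h7 h8 uic c0.
move: (enorm (u i - q)) (enorm (q - p)) h2 h6 h7 h8 uic => r m h2 h6 h7 h8 uic.
move: (enorm _ * enorm _) h1 h6 => E1 h1 h6.
move: (enorm _ * _) h2 h7 => E2 h2 h7.
have {}h6 : E1 <= r * (L * (1 + m)) by rewrite mulrCA mulrA.
have {}h7 : E2 <= r * B / 2 by rewrite [r * B]mulrC mulrAC.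
rewrite mulrC in h8.
lra.
Qed.

(** If the distance from the trajectory [x] to each point of a dense set of
    solutions converges, if the half iterates [y] approach [x], and if the gap at
    [y] is small infinitely often, then the whole trajectory converges to a
    solution. *)
Lemma trajectory_cvg_SVI (D : set 'rV[R]_n) (x y : nat -> 'rV[R]_n) :
  D !=set0 -> D `<=` SVI X F ->
  (forall p e, SVI X F p -> 0 < e -> exists2 q, D q & enorm (p - q) < e) ->
  (forall k, X (y k)) ->
  (forall e, 0 < e -> \forall k \near \oo, enorm (x k - y k) < e) ->
  (forall p, D p -> cvgn (fun k => enorm (x k - p) ^+ 2)) ->
  (forall p, D p -> forall e, 0 < e -> forall N,
     exists2 k, (N <= k)%N & dotrv (F (y k)) (y k - p) < e) ->
  (exists M, forall k, enorm (x k) <= M) /\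
  (forall q, cluster (x @ \oo) q -> SVI X F q).
Proof.
move=> [p0 Dp0] DS Ddense Xy xy xD gapD.
have {}xD p : D p -> cvgn (fun k => enorm (x k - p)).
  move=> /xD/cvg_ex[l xl]; apply/cvg_ex; exists (Num.sqrt l).
  rewrite (_ : (fun k => _) = (fun k => Num.sqrt (enorm (x k - p) ^+ 2))).
    by apply: (cvg_comp _ _ xl); exact: sqrt_continuous.
  by apply/funext => k; rewrite sqrtr_sqr ger0_norm ?enorm_ge0.
have [M xM] : exists M, forall k, enorm (x k - p0) <= M.
  have [M [_ /(_ (M + 1))]] := cvg_seq_bounded (xD _ Dp0).
  rewrite ltrDl ltr01 => /(_ isT) h; exists (M + 1) => k.
  exact: le_trans (ler_norm _) (h k I).
split.
  exists (M + enorm p0) => k; rewrite -[x k](subrK p0).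
  by apply: le_trans (ler_enormD _ _) _; rewrite lerD.
(* a subsequence y_(s i) along which the gap vanishes and y is close to x *)
have [N1 _ N1P] := xy _ (@ltr01 R).
have /choice[s sP] : forall i, exists k, [/\ (i <= k)%N, (N1 <= k)%N &
    dotrv (F (y k)) (y k - p0) < i.+1%:R^-1].
  move=> i; have i0 : 0 < (i.+1%:R^-1 : R) by rewrite invr_gt0 ltr0n.
  have [k] := gapD _ Dp0 _ i0 (maxn i N1).
  by rewrite geq_max => /andP[? ?] ?; exists k.
have [q Xq yq] : exists2 q, X q & seq_cluster (y \o s) q.
  apply: (@bounded_seq_cluster _ _ X (y \o s) p0 (M + 1)) => // [i|i] /=; first exact: Xy.
  have [_ si _] := sP i.
  apply: le_trans (ler_dist_enormD (x (s i)) _ _) _.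
  by rewrite addrC lerD// enormC ltW//; exact: N1P.
have Sq : SVI X F q.
  apply: (seq_cluster_SVI (DS _ Dp0) _ Xq yq) => i /=; first exact: Xy.
  by have [] := sP i.
have xq e : 0 < e -> \forall k \near \oo, enorm (x k - q) < e.
  move=> e0; have e8 : 0 < e / 8 by rewrite divr_gt0.
  (* the limit l of the distances to a point p of D near q is small, since the
     trajectory comes back near q *)
  have [p Dp qp] := Ddense q (e / 8) Sq e8.
  have /cvg_ex[/= l /(@cvgrPdist_lt _ R^o _ _ _ _ _) xl] := xD _ Dp.
  have [N2 _ N2P] := xy _ e8.
  have l4 : l <= e * (3 / 8).
    apply/ler_addgt0Pr => r r0.
    have [N3 _ N3P] : \forall k \near \oo, `|l - enorm (x k - p)| < r.
      exact: xl.
    have [i Ni yqi] := yq _ e8 (maxn N2 N3).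
    have [si _ _] := sP i.
    move: Ni; rewrite geq_max => /andP[Ni2 Ni3].
    have := N2P (s i) (leq_trans Ni2 si); have := N3P (s i) (leq_trans Ni3 si) => /=.
    rewrite ltr_distlC => /andP[h1 _] h2.
    have := ler_dist_enormD (y (s i)) (x (s i)) p.
    have := ler_dist_enormD q (y (s i)) p.
    rewrite /= in yqi; lra.
  have [N3 _ N3P] : \forall k \near \oo, `|l - enorm (x k - p)| < e * (1 / 8).
    by apply: xl; rewrite mulr_gt0.
  exists N3 => // k /N3P /=; rewrite ltr_distlC => /andP[_ h1].
  have := ler_dist_enormD p (x k) q; rewrite (enormC p q); move: h1; lra.
move=> q' /cluster_seq_cluster xq'.
suff -> : q' = q by [].
apply/eqP; rewrite -subr_eq0; apply/eqP/enorm_eq0/eqP.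
rewrite eq_le enorm_ge0 andbT; apply/ler_addgt0Pr => e e0; rewrite add0r.
have e2 : 0 < e / 2 by rewrite divr_gt0.
have [N _ NP] := xq _ e2; have [i Ni h] := xq' _ e2 N.
have := ler_dist_enormD (x i) q' q; rewrite (enormC q' (x i)); have := NP i Ni => /=; lra.
Qed.

End trajectory.

(** * Rational points and Borel measurability of row vectors *)

Section rational_points.
Context (R : realType) (n : nat).
Implicit Types (u v : 'rV[R]_n) (q : 'rV[rat]_n).

(** The vector with the rational coordinates of [q], seen in [R]. *)
Definition ratrv q : 'rV[R]_n := map_mx ratr q.

Lemma ratrv_dense u e : 0 < e -> exists q, enorm (u - ratrv q) < e.
Proof.
move=> e0; have d0 : 0 < e / n.+1%:R by rewrite divr_gt0.
have /choice[q qP] : forall i, exists r : rat, `|u ord0 i - ratr r| <= e / n.+1%:R.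
  move=> i.
  have /rat_in_itvoo[r] : u ord0 i - e / n.+1%:R < u ord0 i + e / n.+1%:R.
    by rewrite ltrD2l gtrN.
  rewrite in_itv/= => /andP[h1 h2]; exists r.
  rewrite ler_distl; move: (ratr r : R) (e / _) h1 h2 => x y h1 h2.
  by apply/andP; split; lra.
exists (\row_i q i); apply: (le_lt_trans (enorm_le_mx_norm _)).
have : `|u - ratrv (\row_i q i)| <= e / n.+1%:R.
  rewrite [leLHS]/Num.Def.normr/= mx_normrE; apply/bigmax_leP; split; first exact: ltW.
  by move=> [i j] _ /=; rewrite ord1 !mxE; exact: qP.
rewrite ler_pdivlMr// mulrC -natr1 mulrDl mul1r => h.
have [u0|u0] := eqVneq `|u - ratrv (\row_i q i)| 0; first by rewrite u0 mulr0.
by apply: lt_le_trans h; rewrite ltrDl lt0r u0 normr_ge0.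
Qed.

Lemma ratrv_ball u e : 0 < e -> exists (q : 'rV[rat]_n) (r : rat),
  enorm (u - ratrv q) < ratr r /\ forall v, enorm (v - ratrv q) < ratr r -> enorm (v - u) < e.
Proof.
move=> e0; have /rat_in_itvoo[r] : 0 < e / 2 by rewrite divr_gt0.
rewrite in_itv/= => /andP[r0 re].
have [q uq] := ratrv_dense u r0; exists q, r; split => // v vq.
have := ler_dist_enormD (ratrv q) v u; rewrite (enormC (ratrv q) u).
move: (ratr r : R) re vq uq => x; lra.
Qed.

Lemma countable_dense_subset (S : set 'rV[R]_n) :
  exists D : set 'rV[R]_n, [/\ countable D, D `<=` S &
    forall p e, S p -> 0 < e -> exists2 q, D q & enorm (p - q) < e].
Proof.
pose B (i : 'rV[rat]_n * rat) := [set v | S v /\ enorm (v - ratrv i.1) < ratr i.2].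
exists ((fun i => get (B i)) @` [set i | B i !=set0]); split.
- by apply: (card_le_trans (card_image_le _ _)); exact: countableP.
- by move=> _ [i [v Bv] <-]; have [] := getPex (ex_intro _ v Bv).
- move=> p e Sp e0; have [q [r [pq qr]]] := ratrv_ball p e0.
  have B0 : B (q, r) !=set0 by exists p.
  exists (get (B (q, r))); first by exists (q, r).
  rewrite enormC; apply: qr.
  by have [v Bv] := B0; have [] := getPex (ex_intro _ v Bv).
Qed.

End rational_points.

Section borelRV.
Context (R : realType) (n : nat).

Lemma continuous_measurable_borelRV m (f : 'rV[R]_n -> 'rV[R]_m) : continuous f ->
  @measurable_fun _ _ (borelRV R n) (borelRV R m) setT f.
Proof.
move=> cf; apply: (@measurability _ _ _ (borelRV R m) _ _ (@open 'rV[R]_m)) => // _ [U oU <-].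
by rewrite setTI; apply: sub_sigma_algebra; move/continuousP: cf; exact.
Qed.

Lemma continuous_measurable_rV (f : 'rV[R]_n -> R) : continuous f ->
  @measurable_fun _ _ (borelRV R n) R setT f.
Proof.
move=> cf; apply: (measurability _ (RGenOInfty.measurableE R)) => _ [_ [a ->] <-].
by rewrite setTI; apply: sub_sigma_algebra; move/continuousP: cf; apply; exact: interval_open.
Qed.

Context (d : measure_display) (T : measurableType d).

Lemma measurable_coord (f : T -> borelRV R n) i :
  measurable_fun setT f -> measurable_fun setT (fun t => f t ord0 i).
Proof.
by apply: (measurableT_comp (continuous_measurable_rV (@coord_continuous _ _ _ ord0 i))).
Qed.

Lemma measurable_dotrv (f g : T -> 'rV[R]_n) :
  (forall i, measurable_fun setT (fun t => f t ord0 i)) ->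
  (forall i, measurable_fun setT (fun t => g t ord0 i)) ->
  measurable_fun setT (fun t => dotrv (f t) (g t)).
Proof. by move=> mf mg; apply: measurable_sum => i; exact: measurable_funM. Qed.

Lemma measurable_enorm (f : T -> 'rV[R]_n) :
  (forall i, measurable_fun setT (fun t => f t ord0 i)) ->
  measurable_fun setT (fun t => enorm (f t)).
Proof.
move=> mf; apply: (measurableT_comp (f := @Num.sqrt R)); last exact: measurable_dotrv.
by apply: continuous_measurable_fun; exact: sqrt_continuous.
Qed.

(** A map into the Borel space of row vectors is measurable as soon as its
    coordinates are, since every open set is a countable union of balls with
    rational centers and radii. *)
Lemma measurable_borelRV (f : T -> borelRV R n) :
  (forall i, measurable_fun setT (fun t => f t ord0 i)) -> measurable_fun setT f.
Proof.
move=> mf; apply: (@measurability _ _ _ (borelRV R n) _ _ (@open 'rV[R]_n)) => // _ [U oU <-].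
rewrite setTI.
pose A (i : 'rV[rat]_n * rat) := [set v : 'rV[R]_n | enorm (v - ratrv R i.1) < ratr i.2].
rewrite (_ : _ @^-1` _ = \bigcup_(i in [set i | A i `<=` U]) f @^-1` (A i)); last first.
  apply/seteqP; split=> [t /= Ut|t [i AU]/=]; last exact: AU.
  have : nbhs (f t) U by rewrite nbhsE/=; exists U.
  move=> /nbhs_ballP[e /= e0 eU].
  have [q [r [fq qr]]] := ratrv_ball (f t) e0.
  exists (q, r) => //= v /qr vft; apply: eU.
  rewrite -ball_normE/= distrC; exact: le_lt_trans (mx_norm_le_enorm _) vft.
rewrite bigcup_mkcond; apply: countable_bigcupT_measurable; first exact: countableP.
move=> i; case: ifP => // _.
rewrite (_ : _ @^-1` _ =
    (fun t => enorm (f t - ratrv R i.1)) @^-1` `]-oo, ratr i.2[%classic); last first.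
  by apply/seteqP; split=> t /=; rewrite in_itv.
rewrite -[X in measurable X]setTI; apply: (measurable_enorm _) => // j.
under eq_fun do rewrite !mxE.
exact: measurable_funB.
Qed.

End borelRV.

(** * Sub-sigma-algebras and expectations *)

Section sub_measurable.
Context (d : measure_display) (T : measurableType d).
Implicit Types (G H : set (set T)).

(** Measurability with respect to the sigma-algebra generated by [G]. *)
Definition sub_measurable G d' (U : measurableType d') (f : T -> U) :=
  @measurable_fun _ _ (g_sigma_algebraType G) U setT f.

Lemma g_sigma_algebra_setT G : <<s G >> setT.
Proof. exact: (@measurableT _ (g_sigma_algebraType G)). Qed.

Lemma sub_measurableS G H d' (U : measurableType d') (f : T -> U) :
  G `<=` <<s H >> -> sub_measurable G f -> sub_measurable H f.
Proof.
move=> GH mf _ B mB; apply: smallest_sub (mf measurableT B mB) => //.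
exact: smallest_sigma_algebra.
Qed.

Lemma sub_measurableW G d' (U : measurableType d') (f : T -> U) :
  G `<=` measurable -> sub_measurable G f -> measurable_fun setT f.
Proof.
move=> GH mf _ B mB; apply: smallest_sub (mf measurableT B mB) => //.
exact: sigma_algebra_measurable.
Qed.

Lemma g_sigma_algebra_preimage_sub G d' (U : measurableType d') (f : T -> U) :
  g_sigma_algebra_preimage f `<=` <<s G >> -> sub_measurable G f.
Proof. by move=> fG _ B mB; apply: fG; exists B. Qed.

End sub_measurable.

Section expectation.
Context (R : realType) (d : measure_display) (T : measurableType d)
        (Q : probability T R).
Implicit Types (G : set (set T)) (f g Z U V : T -> R).

Local Notation integrable f := (Q.-integrable setT (EFin \o f)).

Lemma integrable_measurable f : integrable f -> measurable_fun setT f.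
Proof. by move=> /measurable_int/measurable_EFinP. Qed.

Lemma dominated_integrable f g : measurable_fun setT f ->
  (forall t, `|f t| <= g t) -> integrable g -> integrable f.
Proof.
move=> mf fg; apply: le_integrable => // [|t _]; first exact/measurable_EFinP.
by rewrite /= lee_fin; apply: le_trans (fg t) (ler_norm _).
Qed.

Lemma integrableD_fun f g : integrable f -> integrable g -> integrable (fun t => f t + g t).
Proof. exact: integrableD. Qed.

Lemma integrableZ_fun c f : integrable f -> integrable (fun t => c * f t).
Proof. exact: integrableZl. Qed.

Lemma bounded_integrableM C U Z : measurable_fun setT U -> (forall t, `|U t| <= C) ->
  integrable Z -> integrable (fun t => U t * Z t).
Proof.
move=> mU UC iZ; apply: (@dominated_integrable _ (fun t => C * `|Z t|)).
- by apply: measurable_funM => //; exact: integrable_measurable.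
- by move=> t; rewrite normrM ler_wpM2r.
- by apply: integrableZ_fun; exact: integrable_norm.
Qed.

Lemma sqr_integrable_integrable f : measurable_fun setT f ->
  integrable (fun t => f t ^+ 2) -> integrable f.
Proof.
move=> mf if2; apply: (@dominated_integrable _ (fun t => 1 + f t ^+ 2)) => //.
  move=> t; rewrite ler_norml; have := sqr_ge0 (f t - 1); have := sqr_ge0 (f t + 1); nra.
by apply: integrableD_fun => //; exact: finite_measure_integrable_cst.
Qed.

(** A random variable whose integral vanishes on every event of a
    sub-sigma-algebra is orthogonal to the bounded random variables
    measurable for it. Subtracting [C / 2] times the sign of a variable bounded
    by [C] halves the bound and does not change the integral against [Z]. *)
Lemma orthogonal_of_null_on_events G Z U C :
  G `<=` measurable -> integrable Z ->
  (forall A, <<s G >> A -> \int[Q]_(t in A) Z t = 0) ->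
  sub_measurable G U -> (forall t, `|U t| <= C) ->
  \int[Q]_t (U t * Z t) = 0.
Proof.
move=> Gm iZ Z0 mU UC.
have GmS A : <<s G >> A -> measurable A.
  by apply: smallest_sub => //; exact: sigma_algebra_measurable.
have I0 : 0 <= \int[Q]_t `|Z t| by exact: Rintegral_ge0.
have key k : forall U C, sub_measurable G U -> (forall t, `|U t| <= C) ->
    `|\int[Q]_t (U t * Z t)| <= geometric (C * \int[Q]_t `|Z t|) 2^-1 k.
  elim: k => [|k ih] {mU UC C}U C mU UC; have mU' := sub_measurableW Gm mU.
    rewrite /= expr0 mulr1.
    apply: le_trans (le_normr_Rintegral _ _) _ => //; first exact: bounded_integrableM UC _.
    rewrite -RintegralZl//; last exact: integrable_norm.
    apply: le_Rintegral => //.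
    - by apply: integrable_norm; exact: bounded_integrableM UC _.
    - by apply: integrableZ_fun; exact: integrable_norm.
    - by move=> t _; rewrite normrM ler_wpM2r.
  pose A := U @^-1` `[0, +oo[%classic.
  have GA : <<s G >> A.
    by have := mU measurableT `[0, +oo[%classic (measurable_itv _); rewrite setTI.
  pose V t := U t - (C * \1_A t - C / 2).
  have mV : sub_measurable G V.
    by apply: measurable_funB => //; apply: measurable_funB => //;
      apply: measurable_funM => //; exact: measurable_indic.
  have VC t : `|V t| <= C / 2.
    have := UC t; rewrite /V indicE ler_norml => /andP[h1 h2].
    case: (boolP (t \in A)).
      rewrite inE /A/= in_itv/= andbT => U0; rewrite mulr1 ler_norml; lra.
    rewrite notin_setE /A/= in_itv/= andbT => /negP; rewrite -ltNge => U0.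
    rewrite mulr0 ler_norml; lra.
  have iVZ : integrable (fun t => V t * Z t).
    by apply: (bounded_integrableM _ VC) => //; exact: sub_measurableW Gm mV.
  have iAZ : integrable (fun t => \1_A t * Z t).
    apply: (@bounded_integrableM 1) => // [|t].
      by apply: measurable_indic; exact: GmS.
    by rewrite indicE; case: (t \in A); rewrite ?normr0 ?normr1.
  have -> : \int[Q]_t (U t * Z t) = \int[Q]_t (V t * Z t).
    have AZ : \int[Q]_t (\1_A t * Z t) = 0.
      rewrite -[RHS](Z0 _ GA) [RHS]Rintegral_mkcond; apply: eq_Rintegral => t _.
      by rewrite indicE patchE; case: (t \in A); rewrite ?mul1r ?mul0r.
    have ZT : \int[Q]_t Z t = 0 by apply: Z0; exact: g_sigma_algebra_setT.
    transitivity (\int[Q]_t (V t * Z t + (C * (\1_A t * Z t) + - (C / 2) * Z t))).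
      by apply: eq_Rintegral => t _; rewrite /V; ring.
    rewrite RintegralD//; last by apply: integrableD_fun; exact: integrableZ_fun.
    rewrite RintegralD//; [|exact: integrableZ_fun|exact: integrableZ_fun].
    by rewrite !RintegralZl// AZ ZT !mulr0 !addr0.
  apply: le_trans (ih _ _ mV VC) _; rewrite /= exprS.
  by rewrite le_eqVlt; apply/orP; left; apply/eqP; ring.
apply/eqP; rewrite -normr_le0.
have h2 : `|2^-1 : R| < 1 by rewrite ger0_norm// invf_lt1// ltr1n.
have cg := @cvg_geometric R (C * \int[Q]_t `|Z t|) _ h2.
rewrite -(cvg_lim (@Rhausdorff R) cg); apply: limr_ge.
  by apply/cvg_ex; exists 0.
by apply: nearW => k; exact: key.
Qed.

End expectation.

(** * Almost sure convergence of martingales bounded in L2 *)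

Section L2_martingale.
Context (R : realType) (d : measure_display) (T : measurableType d)
        (Q : probability T R).
Context (G : nat -> set (set T)) (xi : nat -> T -> R).

Local Notation integrable f := (Q.-integrable setT (EFin \o f)).

Hypotheses (Gm : forall k, G k `<=` measurable)
  (xiG : forall i k, (i < k)%N -> sub_measurable (G k) (xi i))
  (xi2 : forall k, integrable (fun t => xi k t ^+ 2))
  (xi_orth : forall k (U : T -> R) C, sub_measurable (G k) U -> (forall t, `|U t| <= C) ->
     \int[Q]_t (U t * xi k t) = 0).

Local Notation s := (series (fun k => \int[Q]_t (xi k t ^+ 2))).

(** The partial sums of [xi] from index [m] on, stopped when their absolute
    value reaches [e]. *)
Fixpoint stopped_sum (e : R) m k (t : T) : R :=
  if k is k'.+1 then
    let S := stopped_sum e m k' t in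
    if `|S| < e then S + xi (m + k')%N t else S
  else 0.

Lemma stopped_sumSE e m k t : stopped_sum e m k.+1 t =
  stopped_sum e m k t + (`|stopped_sum e m k t| < e)%R%:R * xi (m + k)%N t.
Proof. by rewrite /=; case: ifP => _; rewrite ?mul1r ?mul0r ?addr0. Qed.

Lemma stopped_sum_measurable e m k n : (m + k <= n)%N ->
  sub_measurable (G n) (stopped_sum e m k).
Proof.
elim: k => [|k ih]; first by move=> _; exact: measurable_cst.
rewrite addnS => mkn.
have sm : sub_measurable (G n) (stopped_sum e m k) by apply: ih; exact: ltnW.
have xm : sub_measurable (G n) (xi (m + k)%N) by exact: xiG.
apply: measurable_fun_ifT => //.
- apply: measurable_fun_ltr => //; apply: measurableT_comp => //.
- exact: measurable_funD.
Qed.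

(** As long as it has not reached [e], the stopped sum is the partial sum. *)
Lemma stopped_sum_le e m k t : `|stopped_sum e m k t| < e ->
  forall i, (i <= k)%N -> stopped_sum e m i t = series (xi ^~ t) (m + i)%N - series (xi ^~ t) m.
Proof.
elim: k => [|k ih] sk i; first by rewrite leqn0 => /eqP ->; rewrite addn0 subrr.
have sk' : `|stopped_sum e m k t| < e by move: sk => /=; case: ifP => // ->.
rewrite leq_eqVlt => /orP[/eqP ->|]; last by rewrite ltnS; exact: (ih sk').
by rewrite /= sk' (ih sk' k)// addnS seriesSr addrAC.
Qed.

(** The cross terms vanish because the stopped sum is bounded by [e] whenever
    it still moves. *)
Lemma stopped_sum_sqr e m k : 0 < e ->
  integrable (fun t => stopped_sum e m k t ^+ 2) /\
  \int[Q]_t (stopped_sum e m k t ^+ 2) <=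
    s (m + k)%N
    - s m.
Proof.
move=> e0; elim: k => [|k [is2 ih]].
  rewrite addn0 subrr /= expr0n/=; split; first exact: integrable0.
  by rewrite Rintegral_cst// mul0r.
pose A t : R := (`|stopped_sum e m k t| < e)%R%:R.
pose U t := 2 * (A t * stopped_sum e m k t).
have sm : sub_measurable (G (m + k)%N) (stopped_sum e m k) by exact: stopped_sum_measurable.
have mA : sub_measurable (G (m + k)%N) A.
  rewrite (_ : A = (fun t => if `|stopped_sum e m k t| < e then 1 else 0)).
    apply: measurable_fun_ifT => //.
    by apply: measurable_fun_ltr => //; exact: measurableT_comp.
  by apply/funext => t; rewrite /A; case: ifP.
have mU : sub_measurable (G (m + k)%N) U.
  by apply: measurable_funM => //; exact: measurable_funM.
have UC t : `|U t| <= 2 * e.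
  rewrite /U normrM ger0_norm// ler_wpM2l// normrM /A.
  by case: ltP => h; rewrite ?normr1 ?normr0 ?mul1r ?mul0r ltW.
have AC t : `|A t| <= 1 by rewrite /A; case: ltP; rewrite ?normr1 ?normr0.
have mx : measurable_fun setT (xi (m + k)%N).
  exact: (sub_measurableW (Gm (k := _)) (xiG (ltnSn _))).
have ix : integrable (xi (m + k)%N) by exact: sqr_integrable_integrable.
have iU : integrable (fun t => U t * xi (m + k)%N t).
  by apply: (bounded_integrableM _ UC) => //; exact: sub_measurableW mU.
have iA : integrable (fun t => A t * xi (m + k)%N t ^+ 2).
  by apply: (bounded_integrableM _ AC) => //; exact: sub_measurableW mA.
have sE : (fun t => stopped_sum e m k.+1 t ^+ 2) = (fun t => stopped_sum e m k t ^+ 2 +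
    (U t * xi (m + k)%N t + A t * xi (m + k)%N t ^+ 2)).
  apply/funext => t; rewrite stopped_sumSE /U -/(A t).
  have -> : A t * xi (m + k)%N t ^+ 2 = A t ^+ 2 * xi (m + k)%N t ^+ 2.
    by congr (_ * _); rewrite /A; case: ltP; rewrite ?expr1n ?expr0n.
  ring.
rewrite sE; split; first by apply: integrableD_fun => //; exact: integrableD_fun.
rewrite RintegralD//; last exact: integrableD_fun.
rewrite RintegralD// (xi_orth mU UC) add0r addnS seriesSr.
rewrite addrAC lerD//; apply: le_Rintegral => // t _.
by rewrite ler_piMl ?sqr_ge0// (le_trans (ler_norm _)).
Qed.

(** A maximal inequality: the stopped sum has absolute value at least [e] at step
    [k] as soon as one of the partial sums up to that step does. *)
Lemma stopped_sum_markov M e m k : (forall n, s n <= M) -> 0 < e ->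
  (Q [set t | e <= `|stopped_sum e m k t|]%R <=
   ((M - s m) / e ^+ 2)%:E)%E.
Proof.
move=> sM e0; have [i2 h] := stopped_sum_sqr m k e0.
have msm : measurable_fun setT (stopped_sum e m k).
  exact: (sub_measurableW (Gm (k := _)) (stopped_sum_measurable _ (leqnn _))).
set A := [set t | _].
have mA : measurable A.
  rewrite (_ : A = (fun t => `|stopped_sum e m k t|) @^-1` `[e, +oo[%classic); last first.
    by apply/seteqP; split=> t; rewrite /A /= in_itv/= andbT.
  by rewrite -[X in measurable X]setTI; apply: measurableT_comp.
have iA : integrable (\1_A : T -> R) by exact: integrable_indic.
have -> : Q A = (\int[Q]_t (\1_A t : R))%:E.
  rewrite /Rintegral fineK; last exact: integrable_fin_num.
  by rewrite integral_indic// setIT.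
rewrite lee_fin ler_pdivlMr ?exprn_gt0// mulrC -RintegralZl//.
have : \int[Q]_t (stopped_sum e m k t ^+ 2) <= M -
  s m by apply: le_trans h _; rewrite lerB.
apply: le_trans; apply: le_Rintegral => //; first exact: integrableZ_fun.
move=> t _; rewrite indicE; case: (boolP (t \in A)) => [|_]; last by rewrite mulr0 sqr_ge0.
rewrite inE /A/= mulr1 => et; rewrite -[leRHS]real_normK ?num_real//.
by rewrite ler_pXn2r// nnegrE ltW.
Qed.

(** A martingale bounded in [L2] converges almost surely, here written for the
    series of its increments [xi]. The event [N j] is that the partial sums
    oscillate by at least [j.+1%:R^-1] after every index. *)
Lemma L2_martingale_cvg M : (forall n, s n <= M) ->
  \forall t \ae Q, cvgn (series (xi ^~ t)).
Proof.
move=> sM.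
have cs : cvgn s.
  apply: nondecreasing_is_cvgn; last by exists M => _ [k _ <-]; exact: sM.
  by apply: nondecreasing_series => i _ _; apply: Rintegral_ge0 => t _; exact: sqr_ge0.
pose B j m k := [set t | (j.+1%:R^-1 : R) <= `|stopped_sum j.+1%:R^-1 m k t|].
have j0 j : (0 : R) < j.+1%:R^-1 by rewrite invr_gt0.
have mB j m k : measurable (B j m k).
  rewrite /B (_ : [set t | _] = (fun t => `|stopped_sum j.+1%:R^-1 m k t|) @^-1`
      `[j.+1%:R^-1, +oo[%classic); last first.
    by apply/seteqP; split=> t; rewrite /= in_itv/= andbT.
  rewrite -[X in measurable X]setTI; apply: measurableT_comp => //.
  exact: (sub_measurableW (Gm (k := _)) (stopped_sum_measurable _ (leqnn _))).
have ndB j m : {homo B j m : k l / (k <= l)%N >-> (k <= l)%O}.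
  apply/nondecreasing_seqP => k; apply/subsetPset => t; rewrite /B /= => h.
  by rewrite ltNge h.
pose N j := \bigcap_m \bigcup_k B j m k.
have mN j : measurable (N j).
  by apply: bigcapT_measurable => m; exact: bigcupT_measurable.
have QN j : Q (N j) = 0%E.
  have Nm m : (Q (N j) <= ((limn s - s m) / j.+1%:R^-1 ^+ 2)%:E)%E.
    apply: (@le_trans _ _ (Q (\bigcup_k B j m k))).
      apply: le_measure; rewrite ?inE//; first exact: bigcupT_measurable.
      exact: bigcap_inf.
    have cB := nondecreasing_cvg_mu (mu := Q) (mB j m) (bigcupT_measurable _ (mB j m)) (ndB j m).
    rewrite -(cvg_lim (@ereal_hausdorff R) cB); apply: lime_le.
      by apply/cvg_ex; exists (Q (\bigcup_k B j m k)).
    apply: nearW => k; apply: stopped_sum_markov => // n.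
    apply: nondecreasing_cvgn_le => //.
    by apply: nondecreasing_series => i _ _; apply: Rintegral_ge0 => t _; exact: sqr_ge0.
  have Nfin : Q (N j) \is a fin_num by exact: fin_num_measure.
  move: Nm; rewrite -(fineK Nfin); set q := fine _ => Nm.
  have q0 : 0 <= q by exact: fine_ge0.
  suff : limn s <= limn s - q * j.+1%:R^-1 ^+ 2.
    rewrite lerBrDr gerDl pmulr_lle0 ?exprn_gt0// => q0'.
    by congr EFin; apply/eqP; rewrite eq_le q0' q0.
  apply: limr_le => //; apply: nearW => m.
  by have := Nm m; rewrite lee_fin ler_pdivlMr ?exprn_gt0// lerBrDr addrC -lerBrDr.
have : Q.-negligible (\bigcup_j N j).
  by apply: negligible_bigcup => j; apply/negligibleP; [exact: mN|exact: QN].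
apply: negligibleS => t /= ncv; apply: contrapT => Nt; apply: ncv.
apply: cauchy_cvg; apply/cauchy_exP => e e0.
have [j _ /(_ j (leqnn j)) /= je] := near_infty_natSinv_lt (PosNum e0).
have : ~ N j t by move=> ?; apply: Nt; exists j.
move=> /existsNP[m] /not_implyP[_ nB].
exists (series (xi ^~ t) m); exists m => // k /= mk.
have sk : `|stopped_sum j.+1%:R^-1 m (k - m)%N t| < j.+1%:R^-1.
  by rewrite ltNge; apply/negP => h; apply: nB; exists (k - m)%N.
have := stopped_sum_le sk (leqnn _); rewrite subnKC// => E.
rewrite /ball/= distrC -E; exact: lt_trans je.
Qed.

End L2_martingale.

(** * Series with summable expectations *)

Section series_of_expectations.
Context (R : realType) (d : measure_display) (T : measurableType d)
        (Q : probability T R).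

Lemma ae_cvg_series (f : nat -> T -> R) M :
  (forall k t, 0 <= f k t) -> (forall k, Q.-integrable setT (EFin \o f k)) ->
  (forall n, series (fun k => \int[Q]_t f k t) n <= M) ->
  \forall t \ae Q, cvgn (series (f ^~ t)).
Proof.
move=> f0 fi fM.
pose S t := (\sum_(0 <= k <oo) (f k t)%:E)%E.
have mf k : measurable_fun setT (EFin \o f k) by exact: measurable_int (fi k).
have S0 t : (0 <= S t)%E by apply: nneseries_ge0 => k _ _; rewrite lee_fin.
have mS : measurable_fun setT S.
  apply: (@ge0_emeasurable_sum _ _ _ setT (fun k t => (f k t)%:E) xpredT) => [k t _ _|k _].
    by rewrite lee_fin.
  exact: mf.
have SM : (\int[Q]_t S t <= M%:E)%E.
  rewrite integral_nneseries//; last by move=> k t _; rewrite lee_fin.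
  apply: lime_le.
    by apply: is_cvg_nneseries => k _ _; apply: integral_ge0 => t _; rewrite lee_fin.
  apply: nearW => n; apply: (@le_trans _ _ (series (fun k => \int[Q]_t f k t) n)%:E).
    rewrite /series/= -sumEFin; apply: lee_sum => k _.
    rewrite /Rintegral fineK; first exact: lexx.
    exact: (integrable_fin_num measurableT (fi k)).
  by rewrite lee_fin.
have iS : Q.-integrable setT S.
  apply/integrableP; split => //.
  under eq_integral do rewrite gee0_abs//.
  exact: le_lt_trans SM (ltry _).
have := integrable_ae measurableT iS; apply: filterS => t /(_ I) St.
apply: nondecreasing_is_cvgn; first by apply: nondecreasing_series => k _ _.
exists (fine (S t)) => _ [n _ <-]; rewrite -lee_fin fineK// /series/= -sumEFin.
by apply: nneseries_lim_ge => k _ _; rewrite lee_fin.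
Qed.

End series_of_expectations.

(** * A single path of the extragradient scheme *)

Section extragradient_path.
Context (R : realType) (n : nat) (X : set 'rV[R]_n) (F : 'rV[R]_n -> 'rV[R]_n).
Context (L B : R) (gamma : nat -> R).
Hypotheses (X0 : X !=set0) (cX : closed X) (vX : convex_set X)
  (F_pm_plus : pseudomonotone_plus X F) (B0 : 0 < B)
  (F_bnd : forall u, X u -> enorm (F u) <= B / 2)
  (gamma_gt0 : forall k, 0 < gamma k) (gamma_cvg0 : gamma @ \oo --> 0)
  (gamma2 : cvgn (series (fun k => gamma k ^+ 2))).

(** The direction [y - p], divided by [1 + |u - p|^2] and switched off when the
    prediction step from [u] along [g] is longer than [1]. *)
Definition damped_direction (c : R) (u y g p : 'rV[R]_n) : 'rV[R]_n :=
  ((c * enorm g <= 1)%R%:R / (1 + enorm (u - p) ^+ 2)) *: (y - p).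

Lemma enorm_damped_direction c u g p : 0 < c -> X u ->
  enorm (damped_direction c u (eproj X (u - c *: g)) g p) <= 2.
Proof.
move=> c0 Xu; set y := eproj X _.
have v0 := sqr_ge0 (enorm (u - p)).
have W0 : 0 < 1 + enorm (u - p) ^+ 2 by rewrite ltr_wpDr.
rewrite /damped_direction enormZ normrM normfV (gtr0_norm W0).
case: (leP (c * enorm g) 1) => cg; last by rewrite normr0 !mul0r.
rewrite normr1 mul1r mulrC ler_pdivrMr//.
have : enorm (y - u) <= c * enorm g.
  rewrite -{1}(eproj_id X0 cX Xu); apply: le_trans (eproj_nonexpansive _ _ X0 cX vX) _.
  by rewrite addrC addKr enormN enormZ gtr0_norm.
have := ler_dist_enormD u y p.
have := sqr_ge0 (enorm (u - p) - 1); nra.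
Qed.

Variables u y w v : nat -> 'rV[R]_n.
Hypotheses (Xu : forall k, X (u k))
  (yE : forall k, y k = eproj X (u k - gamma k *: (F (u k) + w k)))
  (uE : forall k, u k.+1 = eproj X (u k - gamma k *: (F (y k) + v k)))
  (noise2 : cvgn (series (fun k => gamma k ^+ 2 * (enorm (w k) ^+ 2 + enorm (v k) ^+ 2)))).

Lemma extragradient_mem_half k : X (y k).
Proof. by rewrite yE; case: (eprojP (u k - gamma k *: (F (u k) + w k)) X0 cX). Qed.

Lemma step_length_cvg0 e : 0 < e ->
  \forall k \near \oo, gamma k * enorm (F (u k) + w k) < e.
Proof.
move=> e0.
have := cvg_series_cvg_0 noise2.
move=> /(@cvgrPdist_lt _ R^o _ _ _ _ _)/(_ ((e / 2) ^+ 2)).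
rewrite exprn_gt0 ?divr_gt0// => /(_ isT) h1.
have := gamma_cvg0.
move=> /(@cvgrPdist_lt _ R^o _ _ _ _ _)/(_ (e / B)).
rewrite divr_gt0// => /(_ isT) h2.
near=> k.
have : `|0 - gamma k| < e / B by near: k.
rewrite sub0r normrN gtr0_norm// ltr_pdivlMr// => g1.
have : `|0 - gamma k ^+ 2 * (enorm (w k) ^+ 2 + enorm (v k) ^+ 2)| < (e / 2) ^+ 2 by near: k.
rewrite sub0r normrN ger0_norm; last first.
  by rewrite mulr_ge0// ?sqr_ge0// addr_ge0// sqr_ge0.
move=> g2.
have g3 : gamma k * enorm (w k) < e / 2.
  rewrite -(@ltr_pXn2r _ 2) ?nnegrE ?mulr_ge0 ?divr_ge0 ?enorm_ge0 ?(ltW e0) ?(ltW (gamma_gt0 k))//.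
  apply: le_lt_trans g2; rewrite exprMn ler_wpM2l ?sqr_ge0// lerDl sqr_ge0//.
have g4 : gamma k * enorm (F (u k) + w k) <= gamma k * (B / 2) + gamma k * enorm (w k).
  rewrite -mulrDr ler_wpM2l ?(ltW (gamma_gt0 k))//.
  by apply: le_trans (ler_enormD _ _) _; rewrite lerD2r F_bnd.
apply: le_lt_trans g4 _; lra.
Unshelve. all: by end_near. Qed.

Lemma extragradient_half_step_cvg0 e : 0 < e ->
  \forall k \near \oo, enorm (u k - y k) < e.
Proof.
move=> /step_length_cvg0; apply: filterS => k; apply: le_lt_trans.
rewrite yE -{1}(eproj_id X0 cX (Xu k)).
apply: le_trans (eproj_nonexpansive _ _ X0 cX vX) _.
by rewrite opprB addrC subrK enormZ gtr0_norm.
Qed.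

Variable p : 'rV[R]_n.
Hypotheses (sp : SVI X F p)
  (damped_noise : cvgn (series (fun k => gamma k *
     dotrv (damped_direction (gamma k) (u k) (y k) (F (u k) + w k) p) (v k)))).

(** With [W k] one plus the squared distance from [u k] to the solution [p] and
    [D k] the weighted gap, [W k.+1 <= W k * (1 + a k) - 2 * D k] for large [k],
    and the series of the [a k] converges. *)
Lemma extragradient_path_cvg :
  cvgn (fun k => enorm (u k - p) ^+ 2) /\
  exists M, forall k, series (fun k => gamma k * dotrv (F (y k)) (y k - p)) k <= M.
Proof.
have [Xp _] := sp.
pose W k := 1 + enorm (u k - p) ^+ 2.
have W1 k : 1 <= W k by rewrite lerDl sqr_ge0.
pose D k := gamma k * dotrv (F (y k)) (y k - p).
have D0 k : 0 <= D k.
  rewrite mulr_ge0 ?(ltW (gamma_gt0 k))//.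
  by apply: (SVI_dotrv_ge0 F_pm_plus sp); exact: extragradient_mem_half.
pose x k := gamma k *
     dotrv (damped_direction (gamma k) (u k) (y k) (F (u k) + w k) p) (v k).
pose e k := gamma k ^+ 2 * enorm (F (u k) + w k - (F (y k) + v k)) ^+ 2.
have ce : cvgn (series e).
  pose b k := 3 * (B ^+ 2 * gamma k ^+ 2 +
    gamma k ^+ 2 * (enorm (w k) ^+ 2 + enorm (v k) ^+ 2)).
  apply: (@series_le_cvg _ e b).
  - by move=> k; rewrite mulr_ge0// sqr_ge0.
  - move=> k; rewrite /b mulr_ge0// addr_ge0// mulr_ge0// ?sqr_ge0// addr_ge0 ?sqr_ge0//.
  - move=> k; rewrite /e /b.
    have -> : 3 * (B ^+ 2 * gamma k ^+ 2 + gamma k ^+ 2 * (enorm (w k) ^+ 2 + enorm (v k) ^+ 2))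
       = gamma k ^+ 2 * (3 * (B ^+ 2 + (enorm (w k) ^+ 2 + enorm (v k) ^+ 2))) by ring.
    rewrite ler_wpM2l ?sqr_ge0//.
    have -> : F (u k) + w k - (F (y k) + v k) = (F (u k) - F (y k)) + (w k - v k).
      by rewrite opprD addrACA.
    have h1 := ler_enormD (F (u k) - F (y k)) (w k - v k).
    have h2 := ler_enormD (F (u k)) (- F (y k)); have h3 := ler_enormD (w k) (- v k).
    rewrite enormN in h2; rewrite enormN in h3.
    have h4 := F_bnd (Xu k); have h5 := F_bnd (extragradient_mem_half k).
    set q := enorm (F (u k) - F (y k) + (w k - v k)) in h1 *.
    have q0 : 0 <= q by exact: enorm_ge0.
    have w0 := enorm_ge0 (w k); have v0 := enorm_ge0 (v k).
    have qle : q <= B + enorm (w k) + enorm (v k) by lra.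
    apply: (@le_trans _ _ ((B + enorm (w k) + enorm (v k)) ^+ 2)).
      by rewrite ler_pXn2r ?nnegrE// ?addr_ge0// ltW.
    have := sqr_ge0 (B - enorm (w k)); have := sqr_ge0 (B - enorm (v k)).
    have := sqr_ge0 (enorm (w k) - enorm (v k)); nra.
  - rewrite (_ : series b = 3 *: (B ^+ 2 *: series (fun k => gamma k ^+ 2)
       + series (fun k => gamma k ^+ 2 * (enorm (w k) ^+ 2 + enorm (v k) ^+ 2)))); last first.
      apply/funext => k; rewrite /series/= /b !fctE /= -mulr_sumr big_split/= -mulr_sumr.
      by [].
    apply: is_cvgZr; apply: is_cvgD => //; exact: is_cvgZr.
pose a k := -2 * x k + e k.
have ca : cvgn (series a).
  rewrite (_ : series a = (-2) *: series x + series e).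
    by apply: is_cvgD => //; exact: is_cvgZr.
  by apply/funext => k; rewrite /series/= /a !fctE/= big_split/= -mulr_sumr.
have [K _ KP] := step_length_cvg0 ltr01.
have key k : (K <= k)%N -> W k.+1 <= W k * (1 + a k) - 2 * D k.
  move=> /KP /= /ltW gk.
  have := extragradient_step X0 cX vX Xp (yE k) (uE k).
  rewrite -/(e k) dotrvDl.
  (* the prediction step is short, so the damped direction is (y k - p) / W k *)
  have vx : gamma k * dotrv (v k) (y k - p) = x k * W k.
    rewrite /x /damped_direction gk dotrvZl (dotrvC (y k - p)) -/(W k) /=.
    by field; rewrite gt_eqF// (lt_le_trans ltr01).
  have e0 : 0 <= e k by rewrite mulr_ge0// sqr_ge0.
  have eW : e k <= e k * W k by rewrite ler_peMr.
  rewrite /D; move: (W1 k) vx eW; rewrite /a /W.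
  move: (enorm (u k - p) ^+ 2) (enorm (u k.+1 - p) ^+ 2).
  move: (dotrv (v k) (y k - p)) (dotrv (F (y k)) _).
  move=> dv dF V V' W1k vx eW h.
  have -> : (1 + V) * (1 + (-2 * x k + e k)) = 1 + V - 2 * (x k * (1 + V)) + e k * (1 + V) by ring.
  rewrite -vx; lra.
have [|k|cW [M DM]] := perturbed_decrease _ _ ca key.
- by move=> k; apply: le_trans (W1 k).
- by rewrite mulr_ge0.
split.
  rewrite (_ : (fun k => _) = W - cst 1).
    by apply: is_cvgB => //; exact: is_cvg_cst.
  by apply/funext => k; rewrite /W !fctE/= addrC addKr.
exists (M / 2) => k; rewrite ler_pdivlMr// mulrC /series/= mulr_sumr.
exact: DM.
Qed.

End extragradient_path.

(** * Conditional moments and histories *)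

Section conditional_moments.
Context (R : realType) (d : measure_display) (T : measurableType d)
        (Q : probability T R).
Implicit Types (G : set (set T)) (Z : T -> R).

Lemma cond_exp_ae_eq0_null_on_events G Z : G `<=` measurable ->
  cond_exp_ae_eq Q G Z 0 ->
  Q.-integrable setT (EFin \o Z) /\ forall A, G A -> \int[Q]_(t in A) Z t = 0.
Proof.
move=> Gm [Y [iZ iY _ YZ] Y0]; split => // A GA.
have mA := Gm _ GA.
rewrite /Rintegral -YZ// (ae_eq_integral (cst 0%E))//.
- by rewrite integral0.
- by apply: measurable_funTS; exact: measurable_int iY.
- by apply: filterS Y0 => t Yt _ /=; rewrite Yt.
Qed.

Lemma cond_exp_ae_le_expectation G Z c : G setT -> cond_exp_ae_le Q G Z c ->
  Q.-integrable setT (EFin \o Z) /\ \int[Q]_t Z t <= c.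
Proof.
move=> GT [Y [iZ iY _ YZ] Yle]; split => //.
pose Yc t := Num.min (Y t) c.
have mY : measurable_fun setT Y by exact: integrable_measurable iY.
have mYc : measurable_fun setT Yc by exact: measurable_minr.
have ic : Q.-integrable setT (EFin \o cst c) by exact: finite_measure_integrable_cst.
have iYc : Q.-integrable setT (EFin \o Yc).
  apply: (@dominated_integrable _ _ _ _ _ (fun t => `|Y t| + `|c|)) => //.
    move=> t; rewrite /Yc; case: (ltP (Y t) c) => _; first by rewrite lerDl.
    by rewrite lerDr.
  apply: integrableD_fun; first exact: integrable_norm.
  exact: finite_measure_integrable_cst.
have -> : \int[Q]_t Z t = \int[Q]_t Yc t.
  rewrite /Rintegral -YZ//; congr fine; apply: ae_eq_integral => //.
  - exact/measurable_EFinP.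
  - exact/measurable_EFinP.
  - by apply: filterS Yle => t Yt _; rewrite /Yc min_l.
apply: (@le_trans _ _ (\int[Q]_t c)).
  by apply: le_Rintegral => // t _; rewrite /Yc ge_min lexx orbT.
rewrite Rintegral_cst// [X in fine X](_ : _ = 1%E) ?mulr1//.
exact: probability_setT.
Qed.

End conditional_moments.

Section histories.
Context (R : realType) (n : nat) (d d' : measure_display)
  (Omega : measurableType d) (T : measurableType d').
Context (x0 : T -> borelRV R n) (om omh : nat -> T -> Omega).
Hypotheses (mx0 : measurable_fun setT x0)
  (mom : forall k, measurable_fun setT (om k))
  (momh : forall k, measurable_fun setT (omh k)).

Lemma history_half_history k : history x0 om omh k `<=` history_half x0 om omh k.
Proof. by move=> A hA; apply: sub_sigma_algebra; left. Qed.

Lemma historyS_half k : history_half x0 om omh k `<=` history x0 om omh k.+1.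
Proof.
apply: smallest_sub; first exact: smallest_sigma_algebra.
move=> A [|omA].
  apply: smallest_sub; first exact: smallest_sigma_algebra.
  move=> {}A [x0A|[i /= ik omA]]; apply: sub_sigma_algebra; [by left|right].
  by exists i => //=; exact: ltnW.
by apply: sub_sigma_algebra; right; exists k => /=; [exact: ltnSn|left].
Qed.

Lemma history_measurable k : history x0 om omh k `<=` measurable.
Proof.
apply: smallest_sub; first exact: sigma_algebra_measurable.
have mpre dU (U : measurableType dU) (f : T -> U) : measurable_fun setT f ->
    g_sigma_algebra_preimage f `<=` measurable.
  by move=> mf _ [B mB <-]; exact: mf.
by move=> A [|[i _ []]]; exact: mpre.
Qed.

Lemma history_half_measurable k : history_half x0 om omh k `<=` measurable.
Proof. by move=> A /historyS_half; exact: history_measurable. Qed.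

Lemma sub_measurable_x0 : sub_measurable (history x0 om omh 0) x0.
Proof.
apply: g_sigma_algebra_preimage_sub => A hA.
by apply: sub_sigma_algebra; apply: sub_sigma_algebra; left.
Qed.

Lemma sub_measurable_om k : sub_measurable (history_half x0 om omh k) (om k).
Proof.
apply: g_sigma_algebra_preimage_sub => A hA.
by apply: sub_sigma_algebra; apply: sub_sigma_algebra; right.
Qed.

Lemma sub_measurable_omh k : sub_measurable (history x0 om omh k.+1) (omh k).
Proof.
apply: g_sigma_algebra_preimage_sub => A hA.
apply: sub_sigma_algebra; apply: sub_sigma_algebra; right.
by exists k => /=; [exact: ltnSn|right].
Qed.

Lemma sub_measurable_half k dU (U : measurableType dU) (f : T -> U) :
  sub_measurable (history x0 om omh k) f ->
  sub_measurable (history_half x0 om omh k) f.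
Proof.
apply: sub_measurableS => A hA; apply: sub_sigma_algebra.
exact: history_half_history.
Qed.

Lemma sub_measurable_halfS k dU (U : measurableType dU) (f : T -> U) :
  sub_measurable (history_half x0 om omh k) f ->
  sub_measurable (history x0 om omh k.+1) f.
Proof.
apply: sub_measurableS => A hA; apply: sub_sigma_algebra.
exact: historyS_half.
Qed.

Lemma sub_measurable_history_half i k dU (U : measurableType dU) (f : T -> U) :
  (i < k)%N -> sub_measurable (history x0 om omh i.+1) f ->
  sub_measurable (history_half x0 om omh k) f.
Proof.
elim: k => // k ih; rewrite ltnS leq_eqVlt => /orP[/eqP ->|ik] mf.
  exact: sub_measurable_half.
by apply: sub_measurable_half; apply: sub_measurable_halfS; exact: ih.
Qed.

End histories.

(** * Measurability of the iterates *)

Section scheme.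
Context (R : realType) (n m : nat) (X : set 'rV[R]_n).
Hypotheses (X_nonempty : X !=set0) (X_closed : closed X) (X_convex : convex_set X).
Context (d : measure_display) (Omega : measurableType d)
  (phi : 'rV[R]_n -> Omega -> 'rV[R]_n).
Hypothesis phi_measurable :
  measurable_fun (X `*` [set: Omega] : set (borelRV R n * Omega)%type)
    (fun p : borelRV R n * Omega => phi p.1 p.2 : borelRV R n).

Lemma measurable_oracle dS (S : measurableType dS) (u : S -> borelRV R n) (o : S -> Omega) :
  (forall s, X (u s)) -> measurable_fun setT u -> measurable_fun setT o ->
  measurable_fun setT ((fun s => phi (u s) (o s)) : S -> borelRV R n).
Proof.
move=> Xu mu mo.
have mX : measurable (X : set (borelRV R n)).
  by rewrite -(setCK X); apply: measurableC; apply: sub_sigma_algebra; exact: closed_openC.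
apply: (@measurable_comp _ _ _ S (borelRV R n * Omega)%type (borelRV R n)
  (X `*` [set: Omega]) (fun p : borelRV R n * Omega => phi p.1 p.2) setT
  (fun s => (u s, o s))) => //.
- exact: measurableX.
- by move=> _ [s _ <-]; split => //=; exact: Xu.
- exact: measurable_fun_pair.
Qed.

Lemma measurable_eproj_step dS (S : measurableType dS) c (u g : S -> borelRV R n) :
  measurable_fun setT u -> measurable_fun setT g ->
  measurable_fun setT ((fun s => eproj X (u s - c *: g s)) : S -> borelRV R n).
Proof.
move=> mu mg.
apply: (@measurableT_comp _ _ _ S (borelRV R n) (borelRV R n) (eproj X) setT
  (fun s => u s - c *: g s)).
  apply: continuous_measurable_borelRV; apply: (@lipschitz_enorm_continuous _ _ _ _ 1).
  by move=> v v'; rewrite mul1r; exact: eproj_nonexpansive.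
apply: measurable_borelRV => i.
under eq_fun do rewrite !mxE.
apply: measurable_funB; first exact: measurable_coord.
by apply: measurable_funM => //; exact: measurable_coord.
Qed.

Lemma measurable_lipschitz_on dS (S : measurableType dS) (F : 'rV[R]_n -> 'rV[R]_n) L
    (u : S -> borelRV R n) : 0 < L ->
  (forall a b, X a -> X b -> enorm (F a - F b) <= L * enorm (a - b)) ->
  (forall s, X (u s)) -> measurable_fun setT u ->
  measurable_fun setT ((fun s => F (u s)) : S -> borelRV R n).
Proof.
move=> L0 FL Xu mu.
(* F composed with the projection is Lipschitz on the whole space *)
rewrite (_ : (fun s => F (u s)) = (F \o eproj X) \o u); last first.
  by apply/funext => s /=; rewrite eproj_id.
apply: (@measurableT_comp _ _ _ S (borelRV R n) (borelRV R n) (F \o eproj X) setT u) => //.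
apply: continuous_measurable_borelRV; apply: (@lipschitz_enorm_continuous _ _ _ _ L).
move=> v v' /=.
have [Xv _] := eprojP v X_nonempty X_closed; have [Xv' _] := eprojP v' X_nonempty X_closed.
by apply: le_trans (FL _ _ Xv Xv') _; rewrite ler_pM2l// eproj_nonexpansive.
Qed.

Context (d' : measure_display) (T : measurableType d') (x0 : T -> borelRV R n)
  (om omh : nat -> T -> Omega) (gamma : nat -> R) (x xh : nat -> T -> 'rV[R]_n).
Hypotheses (Xx : forall k t, X (x k t)) (Xxh : forall k t, X (xh k t))
  (x_init : x 0%N = x0)
  (xhE : forall k, xh k = fun t => eproj X (x k t - gamma k *: phi (x k t) (om k t)))
  (xE : forall k, x k.+1 = fun t => eproj X (x k t - gamma k *: phi (xh k t) (omh k t))).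

Local Notation H := (history x0 om omh).
Local Notation Hh := (history_half x0 om omh).

Lemma sub_measurable_half_iterate k :
  sub_measurable (H k) (x k : T -> borelRV R n) ->
  sub_measurable (Hh k) (xh k : T -> borelRV R n).
Proof.
move=> mx; rewrite xhE.
have mx' : sub_measurable (Hh k) (x k : T -> borelRV R n) by exact: sub_measurable_half.
apply: measurable_eproj_step => //; apply: measurable_oracle => //.
exact: sub_measurable_om.
Qed.

Lemma sub_measurable_iterate k : sub_measurable (H k) (x k : T -> borelRV R n).
Proof.
elim: k => [|k ih]; first by rewrite x_init; exact: sub_measurable_x0.
have mx : sub_measurable (H k.+1) (x k : T -> borelRV R n).
  by apply: sub_measurable_halfS; exact: sub_measurable_half.
have mxh : sub_measurable (H k.+1) (xh k : T -> borelRV R n).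
  by apply: sub_measurable_halfS; exact: sub_measurable_half_iterate.
rewrite xE; apply: measurable_eproj_step => //; apply: measurable_oracle => //.
exact: sub_measurable_omh.
Qed.

Context (L : R) (F : 'rV[R]_n -> 'rV[R]_n).
Hypotheses (L_gt0 : 0 < L)
  (FL : forall a b, X a -> X b -> enorm (F a - F b) <= L * enorm (a - b)).

Lemma sub_measurable_noise_half k j :
  sub_measurable (H k.+1) (fun t => (phi (xh k t) (omh k t) - F (xh k t)) ord0 j).
Proof.
have mxh : sub_measurable (H k.+1) (xh k : T -> borelRV R n).
  apply: sub_measurable_halfS; apply: sub_measurable_half_iterate.
  exact: sub_measurable_iterate.
rewrite (_ : (fun t => _) = (fun t => phi (xh k t) (omh k t) ord0 j - F (xh k t) ord0 j)).
  apply: measurable_funB; apply: measurable_coord; last exact: measurable_lipschitz_on FL _ _.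
  by apply: measurable_oracle => //; exact: sub_measurable_omh.
by apply/funext => t; rewrite !mxE.
Qed.

Lemma sub_measurable_damped_direction k p j :
  sub_measurable (Hh k) (fun t => damped_direction (gamma k) (x k t) (xh k t)
    (phi (x k t) (om k t)) p ord0 j).
Proof.
have mx : sub_measurable (Hh k) (x k : T -> borelRV R n).
  by apply: sub_measurable_half; exact: sub_measurable_iterate.
have mxh : sub_measurable (Hh k) (xh k : T -> borelRV R n).
  by apply: sub_measurable_half_iterate; exact: sub_measurable_iterate.
have mphi : sub_measurable (Hh k) ((fun t => phi (x k t) (om k t)) : T -> borelRV R n).
  by apply: measurable_oracle => //; exact: sub_measurable_om.
rewrite /damped_direction.
under eq_fun do rewrite !mxE.
apply: measurable_funM; last first.
  by apply: measurable_funB => //; exact: measurable_coord.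
apply: measurable_funM.
  rewrite (_ : (fun t => _) = (fun t =>
      if gamma k * enorm (phi (x k t) (om k t)) <= 1 then 1 else 0)).
    apply: measurable_fun_ifT => //; apply: measurable_fun_ler => //.
    by apply: measurable_funM => //; apply: measurable_enorm => i; exact: measurable_coord.
  by apply/funext => t; case: ifP.
rewrite (_ : (fun t => _) = (fun r : R => (1 + `|r|)^-1) \o (fun t => enorm (x k t - p) ^+ 2)).
  apply: measurableT_comp.
    apply: continuous_measurable_fun => r.
    apply: cvgV; first by rewrite gt_eqF// ltr_wpDr.
    by apply: cvgD; [exact: cvg_cst|exact: norm_continuous].
  apply: measurable_funX; apply: measurable_enorm => i.
  under eq_fun do rewrite !mxE.
  by apply: measurable_funB => //; exact: measurable_coord.
by apply/funext => t /=; rewrite ger0_norm// sqr_ge0.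
Qed.

End scheme.

(** * The weighted noise *)

Section weighted_noise.
Context (R : realType) (n : nat) (d : measure_display) (T : measurableType d)
  (Q : probability T R).
Context (G : nat -> set (set T)) (gamma : nat -> R) (C nu : R)
  (U V : nat -> T -> 'rV[R]_n).
Hypotheses (Gm : forall k, G k `<=` measurable)
  (mU : forall k j, sub_measurable (G k) (fun t => U k t ord0 j))
  (mUS : forall i k j, (i < k)%N -> sub_measurable (G k) (fun t => U i t ord0 j))
  (mVS : forall i k j, (i < k)%N -> sub_measurable (G k) (fun t => V i t ord0 j))
  (UC : forall k t, enorm (U k t) <= C)
  (V1 : forall k j, Q.-integrable setT (EFin \o (fun t => V k t ord0 j)))
  (V0 : forall k j A, <<s G k >> A -> \int[Q]_(t in A) (V k t ord0 j) = 0)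
  (V2 : forall k, Q.-integrable setT (EFin \o (fun t => enorm (V k t) ^+ 2)))
  (Vnu : forall k, \int[Q]_t (enorm (V k t) ^+ 2) <= nu ^+ 2)
  (gamma2 : cvgn (series (fun k => gamma k ^+ 2))).

(** The noise, conditionally centered and bounded in [L2], paired with
    bounded directions known before it is drawn, has an almost surely
    convergent series for square-summable weights. *)
Lemma weighted_noise_cvg :
  \forall t \ae Q, cvgn (series (fun k => gamma k * dotrv (U k t) (V k t))).
Proof.
pose xi k t := gamma k * dotrv (U k t) (V k t).
have mxiS i k : (i < k)%N -> sub_measurable (G k) (xi i).
  move=> ik; apply: measurable_funM => //.
  by apply: measurable_dotrv => j; [exact: mUS|exact: mVS].
have mxi k : measurable_fun setT (xi k).
  exact: (sub_measurableW (Gm (k := _)) (mxiS _ _ (ltnSn k))).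
pose b k t := (gamma k ^+ 2 * C ^+ 2) * enorm (V k t) ^+ 2.
have xib k t : xi k t ^+ 2 <= b k t.
  rewrite /xi /b exprMn -mulrA ler_wpM2l ?sqr_ge0//.
  rewrite -[leLHS]real_normK ?num_real// -exprMn.
  have C0 : 0 <= C by apply: le_trans (UC k t); exact: enorm_ge0.
  rewrite ler_pXn2r ?nnegrE ?mulr_ge0 ?enorm_ge0//.
  apply: (@le_trans _ _ (enorm (U k t) * enorm (V k t))).
    rewrite ler_norml dotrv_le_enorm andbT lerNl -dotrvNl.
    by apply: le_trans (dotrv_le_enorm _ _) _; rewrite enormN.
  by rewrite ler_wpM2r// enorm_ge0.
have ib k : Q.-integrable setT (EFin \o b k) by exact: integrableZ_fun.
have ixi2 k : Q.-integrable setT (EFin \o (fun t => xi k t ^+ 2)).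
  apply: dominated_integrable (ib k); first exact: measurable_funX.
  by move=> t; rewrite ger0_norm ?sqr_ge0.
have intb k : \int[Q]_t (xi k t ^+ 2) <= C ^+ 2 * nu ^+ 2 * gamma k ^+ 2.
  apply: (@le_trans _ _ (\int[Q]_t b k t)); first exact: le_Rintegral.
  have -> : C ^+ 2 * nu ^+ 2 * gamma k ^+ 2 = gamma k ^+ 2 * C ^+ 2 * nu ^+ 2 by ring.
  by rewrite RintegralZl// ler_wpM2l// mulr_ge0 ?sqr_ge0.
apply: (@L2_martingale_cvg _ _ _ Q G xi _ _ _ _
  (C ^+ 2 * nu ^+ 2 * limn (series (fun k => gamma k ^+ 2)))) => //.
- move=> k W D mW WD.
  have -> : \int[Q]_t (W t * xi k t) =
      \int[Q]_t (\sum_(j < n) gamma k * ((W t * U k t ord0 j) * V k t ord0 j)).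
    apply: eq_Rintegral => t _; rewrite /xi /dotrv mulrCA -mulr_sumr; congr (_ * _).
    by rewrite mulr_sumr; apply: eq_bigr => j _; rewrite mulrA.
  have WUD j t : `|W t * U k t ord0 j| <= D * C.
    rewrite normrM; apply: ler_pM => //; exact: le_trans (coord_le_enorm _ _) (UC k t).
  have mWU j : sub_measurable (G k) (fun t => W t * U k t ord0 j).
    by apply: measurable_funM => //; exact: mU.
  have iWUV j : Q.-integrable setT (EFin \o (fun t => (W t * U k t ord0 j) * V k t ord0 j)).
    by apply: (bounded_integrableM _ (WUD j)) => //; exact: sub_measurableW (mWU j).
  suff : forall r : seq 'I_n,
      Q.-integrable setT (EFin \o (fun t =>
        \sum_(j <- r) gamma k * ((W t * U k t ord0 j) * V k t ord0 j))) /\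
      \int[Q]_t (\sum_(j <- r) gamma k * ((W t * U k t ord0 j) * V k t ord0 j)) = 0.
    by move=> /(_ (index_enum 'I_n))[].
  elim=> [|j r [ir IH]].
    split; under eq_fun do rewrite big_nil; first exact: integrable0.
    by rewrite Rintegral_cst// mul0r.
  split; under eq_fun do rewrite big_cons.
    by apply: integrableD_fun => //; exact: integrableZ_fun.
  rewrite RintegralD//; last exact: integrableZ_fun.
  rewrite IH addr0 RintegralZl// (orthogonal_of_null_on_events _ _ _ (mWU j) (WUD j))//.
  + by rewrite mulr0.
  + by move=> A GA; exact: V0.
- move=> N; apply: (@le_trans _ _ (series (fun k => C ^+ 2 * nu ^+ 2 * gamma k ^+ 2) N)).
    by apply: ler_sum => k _; exact: intb.
  have -> : series (fun k => C ^+ 2 * nu ^+ 2 * gamma k ^+ 2) N =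
      C ^+ 2 * nu ^+ 2 * series (fun k => gamma k ^+ 2) N by rewrite /series/= mulr_sumr.
  apply: ler_wpM2l; first by rewrite -exprMn sqr_ge0.
  apply: nondecreasing_cvgn_le => //.
  by apply: nondecreasing_series => i _ _; exact: sqr_ge0.
Qed.

End weighted_noise.

(** * Almost sure convergence of the scheme *)

Theorem proposition1 (R : realType) (n m : nat)
  (* constraint set *)
  (X : set 'rV[R]_n) (X_nonempty : X !=set0) (X_closed : closed X)
  (X_convex : convex_set X)
  (* probability space carrying xi; F(x; omega) = Fxi x (xi omega), and F is its mean *)
  (d : measure_display) (Omega : measurableType d) (P : probability Omega R)
  (xi : {RV P >-> borelRV R m})
  (Fxi : 'rV[R]_n -> 'rV[R]_m -> 'rV[R]_n)
  (Fxi_measurable :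
    measurable_fun (X `*` [set: Omega] : set (borelRV R n * Omega)%type)
      (fun p : borelRV R n * Omega => Fxi p.1 (xi p.2) : borelRV R n))
  (Fxi_integrable : forall x, X x -> forall j,
    P.-integrable [set: Omega] (fun w => (Fxi x (xi w) ord0 j)%:E))
  (F : 'rV[R]_n -> 'rV[R]_n)
  (F_mean : forall x, X x -> forall j,
    ((F x ord0 j)%:E = 'E_P[fun w => Fxi x (xi w) ord0 j])%E)
  (* probability space carrying the initial point and the samples
     omega_k = om k, omega_(k+1/2) = omh k *)
  (d' : measure_display) (T : measurableType d') (Q : probability T R)
  (x0 : {RV Q >-> borelRV R n}) (x0_in_X : forall t, X (x0 t))
  (om omh : nat -> {RV Q >-> Omega})
  (gamma : nat -> R) (gamma_gt0 : forall k, 0 < gamma k)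
  (gamma_cvg0 : gamma @ \oo --> 0)
  (* the scheme: x k = x_k, xh k = x_(k+1/2), with noises w k, wh k *)
  (x xh w wh : nat -> T -> 'rV[R]_n)
  (w_def : forall k t,
    w k t = Fxi (x k t) (xi (om k t)) - F (x k t))
  (wh_def : forall k t,
    wh k t = Fxi (xh k t) (xi (omh k t)) - F (xh k t))
  (x_init : forall t, x 0%N t = x0 t)
  (xh_def : forall k t,
    xh k t = eproj X (x k t - gamma k *: (F (x k t) + w k t)))
  (x_step : forall k t,
    x k.+1 t = eproj X (x k t - gamma k *: (F (xh k t) + wh k t)))
  (F_pm_plus : pseudomonotone_plus X F)
  (SVI_nonempty : SVI X F !=set0)
  (A1 : forall k j,
    cond_exp_ae_eq Q (history x0 om omh k) (fun t => w k t ord0 j) 0 /\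
    cond_exp_ae_eq Q (history_half x0 om omh k) (fun t => wh k t ord0 j) 0)
  (A2 : exists2 nu : R, 0 < nu & forall k,
    cond_exp_ae_le Q (history x0 om omh k)
      (fun t => enorm (w k t) ^+ 2) (nu ^+ 2) /\
    cond_exp_ae_le Q (history_half x0 om omh k)
      (fun t => enorm (wh k t) ^+ 2) (nu ^+ 2))
  (A3 : cvgn (series (fun k => gamma k ^+ 2)))
  (A4 : series gamma @ \oo --> +oo)
  (A5 : exists L B : R, [/\ 0 < L, 0 < B,
    (forall u v, X u -> X v -> enorm (F u - F v) <= L * enorm (u - v)) &
    (forall u, X u -> enorm (F u) <= B / 2)]) :
  \forall t \ae Q,
    (exists M : R, forall k, enorm (x k t) <= M) /\
    (forall p, cluster ((fun k => x k t) @ \oo) p -> SVI X F p).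
Proof.
have [L [B [L_gt0 B_gt0 FL F_bnd]]] := A5.
have [nu nu_gt0 A2'] := A2.
pose phi v o := Fxi v (xi o).
have FwE k t : F (x k t) + w k t = phi (x k t) (om k t) by rewrite w_def addrC subrK.
have FwhE k t : F (xh k t) + wh k t = phi (xh k t) (omh k t).
  by rewrite wh_def addrC subrK.
have Xproj v : X (eproj X v) by have [] := eprojP v X_nonempty X_closed.
have Xx k t : X (x k t) by case: k => [|k]; rewrite ?x_init ?x_step.
have Xxh k t : X (xh k t) by rewrite xh_def.
have mx0 : measurable_fun setT x0 by exact: measurable_funPT.
have mom k : measurable_fun setT (om k) by exact: measurable_funPT.
have momh k : measurable_fun setT (omh k) by exact: measurable_funPT.
have Hm := history_measurable mx0 mom momh.
have Hhm := history_half_measurable mx0 mom momh.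
have x_initE : x 0%N = x0 by exact/funext.
have xhE k : xh k = fun t => eproj X (x k t - gamma k *: phi (x k t) (om k t)).
  by apply/funext => t; rewrite xh_def FwE.
have xE k : x k.+1 = fun t => eproj X (x k t - gamma k *: phi (xh k t) (omh k t)).
  by apply/funext => t; rewrite x_step FwhE.
have HhK k A : <<s history_half x0 om omh k >> A -> history_half x0 om omh k A.
  by apply: smallest_sub => //; exact: smallest_sigma_algebra.
have whE k t : wh k t = phi (xh k t) (omh k t) - F (xh k t) by rewrite wh_def.
have w2 k : Q.-integrable setT (EFin \o (fun t => enorm (w k t) ^+ 2)) /\
    \int[Q]_t (enorm (w k t) ^+ 2) <= nu ^+ 2.
  by apply: cond_exp_ae_le_expectation (A2' k).1; exact: g_sigma_algebra_setT.
have wh2 k : Q.-integrable setT (EFin \o (fun t => enorm (wh k t) ^+ 2)) /\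
    \int[Q]_t (enorm (wh k t) ^+ 2) <= nu ^+ 2.
  by apply: cond_exp_ae_le_expectation (A2' k).2; exact: g_sigma_algebra_setT.
have wh0 k j := cond_exp_ae_eq0_null_on_events (Hhm k) (A1 k j).2.
have [D [D_count DS D_dense]] := countable_dense_subset (SVI X F).
have noise2 : \forall t \ae Q,
    cvgn (series (fun k => gamma k ^+ 2 * (enorm (w k t) ^+ 2 + enorm (wh k t) ^+ 2))).
  apply: (@ae_cvg_series _ _ _ Q
    (fun k t => gamma k ^+ 2 * (enorm (w k t) ^+ 2 + enorm (wh k t) ^+ 2))
    (2 * nu ^+ 2 * limn (series (fun k => gamma k ^+ 2)))).
  - by move=> k t; rewrite mulr_ge0 ?addr_ge0 ?sqr_ge0.
  - by move=> k; apply: integrableZ_fun; apply: integrableD_fun; [exact: (w2 k).1|exact: (wh2 k).1].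
  - move=> N; apply: (@le_trans _ _ (2 * nu ^+ 2 * series (fun k => gamma k ^+ 2) N)).
      rewrite /series/= mulr_sumr; apply: ler_sum => k _.
      rewrite RintegralZl//; last first.
        by apply: integrableD_fun; [exact: (w2 k).1|exact: (wh2 k).1].
      rewrite mulrC ler_wpM2r ?sqr_ge0// RintegralD//; [|exact: (w2 k).1|exact: (wh2 k).1].
      by rewrite mulr_natl mulr2n lerD//; [exact: (w2 k).2|exact: (wh2 k).2].
    apply: ler_wpM2l; first by rewrite mulr_ge0// sqr_ge0.
    apply: nondecreasing_cvgn_le => //.
    by apply: nondecreasing_series => i _ _; exact: sqr_ge0.
have mdir p k j : sub_measurable (history_half x0 om omh k) (fun t =>
    damped_direction (gamma k) (x k t) (xh k t) (F (x k t) + w k t) p ord0 j).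
  rewrite (_ : (fun t => _) = (fun t => damped_direction (gamma k) (x k t) (xh k t)
    (phi (x k t) (om k t)) p ord0 j)); last by apply/funext => t; rewrite FwE.
  exact: (sub_measurable_damped_direction X_nonempty X_closed X_convex Fxi_measurable
    Xx Xxh x_initE xhE xE).
have mwh k j : sub_measurable (history x0 om omh k.+1) (fun t => wh k t ord0 j).
  rewrite (_ : (fun t => _) = (fun t => (phi (xh k t) (omh k t) - F (xh k t)) ord0 j)).
    exact: (sub_measurable_noise_half X_nonempty X_closed X_convex Fxi_measurable
      Xx Xxh x_initE xhE xE L_gt0 FL).
  by apply/funext => t; rewrite whE.
have damped p : \forall t \ae Q, cvgn (series (fun k => gamma k *
    dotrv (damped_direction (gamma k) (x k t) (xh k t) (F (x k t) + w k t) p) (wh k t))).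
  apply: (@weighted_noise_cvg _ _ _ _ Q (history_half x0 om omh) gamma 2 nu
    (fun k t => damped_direction (gamma k) (x k t) (xh k t) (F (x k t) + w k t) p) wh) => //.
  - move=> i k j ik; apply: (sub_measurable_history_half ik).
    by apply: sub_measurable_halfS; exact: mdir.
  - by move=> i k j ik; apply: (sub_measurable_history_half ik); exact: mwh.
  - move=> k t; rewrite xh_def; exact: enorm_damped_direction.
  - by move=> k j; exact: (wh0 k j).1.
  - by move=> k j A /HhK; exact: (wh0 k j).2.
  - by move=> k; exact: (wh2 k).1.
  - by move=> k; exact: (wh2 k).2.
have dampedD : \forall t \ae Q, forall p, D p -> cvgn (series (fun k => gamma k *
    dotrv (damped_direction (gamma k) (x k t) (xh k t) (F (x k t) + w k t) p) (wh k t))).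
  (* the points of D are enumerated by an injection into nat *)
  have [f finj] := countable_injP D D_count.
  have : \forall t \ae Q, forall i p, D p -> f p = i -> cvgn (series (fun k => gamma k *
      dotrv (damped_direction (gamma k) (x k t) (xh k t) (F (x k t) + w k t) p) (wh k t))).
    apply: ae_foralln => i.
    have [[p [Dp fp]]|np] := pselect (exists p, D p /\ f p = i).
      apply: filterS (damped p) => t cp q Dq fq.
      by rewrite (finj q p) ?inE// fp fq.
    by apply: nearW => t p Dp fp; exfalso; apply: np; exists p.
  by apply: filterS => t h p Dp; exact: h Dp erefl.
apply: filterS2 noise2 dampedD => t noise2 damped_t.
have cvgD p (Dp : D p) := extragradient_path_cvg X_nonempty X_closed X_convex
  F_pm_plus B_gt0 F_bnd gamma_gt0 gamma_cvg0 A3 (fun k => Xx k t)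
  (fun k => xh_def k t) (fun k => x_step k t) noise2 (DS _ Dp) (damped_t p Dp).
apply: (trajectory_cvg_SVI X_closed F_pm_plus FL F_bnd L_gt0 B_gt0 _ DS D_dense
  (fun k => Xxh k t)).
- have [p sp] := SVI_nonempty; have [q Dq _] := D_dense p 1 sp ltr01.
  by exists q.
- exact: (extragradient_half_step_cvg0 X_nonempty X_closed X_convex B_gt0 F_bnd
    gamma_gt0 gamma_cvg0 (fun k => Xx k t) (fun k => xh_def k t) noise2).
- by move=> p Dp; exact: (cvgD p Dp).1.
- move=> p Dp; have [_ [M gapM]] := cvgD p Dp.
  apply: (bounded_weighted_series_frequently_small gamma_gt0 A4 _ gapM) => k.
  by apply: (SVI_dotrv_ge0 F_pm_plus); [exact: DS|exact: Xxh].
Qed.
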